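(* Let $q\ge 4$ be a power of $2$, let $D$ be the standard derivation set on the line at infinity $\ell_\infty$ of $\mathrm{PG}(2,q^2)$, and let $K$ be a hyperbola in $\mathrm{PG}(2,q^2)$ whose two infinite points either both belong to $D$, or are conjugate points outside $D$. Then $K$ is defined over a Baer subplane containing $D$, i.e. there is a Baer subplane $B$ containing $D$ such that $K\cap B$ is a conic of $B$. Hence the line of the Hall plane $\mathrm{Hall}(q^2)$ given by the affine part of $B$ contains $q-1$ points of the affine part of $K$ (if the infinite points of $K$ belong to $D$), respectively $q+1$ points of the affine part of $K$ (if the infinite points of $K$ are conjugate), and every other line of the Hall plane intersects the affine part of $K$ in at most two points.
   Context: Use homogeneous coordinates $(X:Y:Z)$ in $\mathrm{PG}(2,q^2)$ with line at infinity $\ell_\infty: Z=0$, so $\mathrm{AG}(2,q^2)=\mathrm{PG}(2,q^2)\setminus\ell_\infty$. The standard derivation set is $D=\{(x:y:0)\mid x,y\in\mathrm{GF}(q),\ (x,y)\neq(0,0)\}\subset\ell_\infty$. The affine Hall plane $\mathrm{Hall}(q^2)$ has as points the points of $\mathrm{AG}(2,q^2)$; its lines are the ''old lines'', i.e. the affine parts of the lines of $\mathrm{PG}(2,q^2)$ other than $\ell_\infty$ whose infinite point is not in $D$, and the ''new lines'', i.e. the affine parts $B\setminus\ell_\infty$ of the Baer subplanes $B$ (subplanes of order $q$) of $\mathrm{PG}(2,q^2)$ containing $D$; explicitly, the new lines are the sets $\{(a+\lambda u,b+\lambda v): u,v\in\mathrm{GF}(q)\}$ with $a,b\in\mathrm{GF}(q^2)$,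 $\lambda\in\mathrm{GF}(q^2)^*$. Conic means irreducible conic. A hyperbola is a conic of $\mathrm{PG}(2,q^2)$ having exactly two points on $\ell_\infty$ (its infinite points); its affine part is $K\setminus\ell_\infty$. Two points of $\ell_\infty\setminus D$ are conjugate (with respect to $D$) if they are interchanged by $(x:y:0)\mapsto(x^q:y^q:0)$. *)

(* Defs.v *)
From HB Require Import structures.
From mathcomp Require Import all_boot all_order all_algebra.
From mathcomp Require Export mpoly.

Set Implicit Arguments.
Unset Strict Implicit.
Unset Printing Implicit Defensive.

Import GRing.Theory.
Local Open Scope ring_scope.

(* Subspaces of a vector space over a finite field form a finite type, so that
   sets of points of PG(2, F) are finite sets and can be counted. *)
Module SpaceFinite.
Import VectorInternalTheory.
HB.instance Definition _ (F : finFieldType) (vT : vectType F) :=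
  [Countable of {vspace vT} by <:].
HB.instance Definition _ (F : finFieldType) (vT : vectType F) :=
  [Finite of {vspace vT} by <:].
End SpaceFinite.
HB.export SpaceFinite.

Section Plane.

Variable F : finFieldType.

(* PG(2, F) is the lattice of subspaces of F^3: points are the subspaces of
   dimension 1 and lines are those of dimension 2, each line being identified
   with the set of points on it. *)
Definition subspace : finType := {vspace 'rV[F]_3}.

Definition points : {set subspace} := [set P : subspace | \dim P == 1%N].

Definition line_of (W : subspace) : {set subspace} :=
  [set P in points | (P <= W)%VS].

Definition lines : {set {set subspace}} :=
  [set line_of W | W : subspace & \dim W == 2%N].

(* The point (x : y : z); meaningful when (x, y, z) != 0. *)
Definition pt (x y z : F) : subspace :=
  <[\row_(i < 3) [:: x; y; z]`_i]>%VS.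

Definition linf : {set subspace} :=
  [set P in points | [forall v : 'rV[F]_3, (v \in P) ==> (v 0 ord_max == 0)]].

Definition affine_part (S : {set subspace}) : {set subspace} := S :\: linf.

(* The subfield GF(q) of a field F of order q ^ 2. *)
Definition GF (q : nat) : {set F} := [set x | x ^+ q == x].

Definition derivation_set (q : nat) : {set subspace} :=
  [set P : subspace | [exists x in GF q, exists y in GF q,
     ((x, y) != (0, 0)) && (P == pt x y 0)]].

Definition secants (B : {set subspace}) : {set {set subspace}} :=
  [set l in lines | (2 <= #|l :&: B|)%N].

(* A subplane of order n: a set B of points which, together with the traces on
   B of the lines of PG(2, F) having at least two points in B, is a projective
   plane with n + 1 points on each line.  That two points of B are on exactly
   one such line is inherited from PG(2, F). *)
Definition subplane (n : nat) (B : {set subspace}) : Prop :=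
  [/\ B \subset points,
      (forall l m, l \in secants B -> m \in secants B -> l != m ->
         exists2 P, P \in B & P \in l :&: m),
      (exists S : {set subspace},
         [/\ S \subset B, #|S| = 4%N &
             forall l, l \in lines -> (#|S :&: l| <= 2)%N]) &
      (forall l, l \in secants B -> #|l :&: B| = n.+1%N)].

(* When #|F| = q ^ 2, these are the Baer subplanes of PG(2, F). *)
Definition baer_subplane (q : nat) (B : {set subspace}) : Prop := subplane q B.

Definition mpoly_irreducible (K : fieldType) (n : nat) (p : {mpoly K[n]}) :
    Prop :=
  (1 < msize p)%N /\
  (forall a b : {mpoly K[n]}, p = a * b -> (msize a <= 1)%N \/ (msize b <= 1)%N).

Definition abs_irreducible (n : nat) (p : {mpoly F[n]}) : Prop :=
  forall (L : fieldType) (f : {rmorphism F -> L}),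
    mpoly_irreducible (map_mpoly f p).

Definition zeros (Q : {mpoly F[3]}) : {set subspace} :=
  [set P in points |
     [forall v : 'rV[F]_3, (v \in P) ==> (Q.@[fun i => v 0 i] == 0)]].

(* Irreducibility of a conic is geometric (over every extension field): a form
   splitting only over a quadratic extension of F has a single point. *)
Definition conic (K : {set subspace}) : Prop :=
  exists Q : {mpoly F[3]},
    [/\ Q \is 2.-homog, abs_irreducible Q & K = zeros Q].

Definition hyperbola (K : {set subspace}) : Prop :=
  conic K /\ #|K :&: linf| = 2%N.

(* The canonical subplane PG(2, q): points with coordinates in GF(q). *)
Definition PGsub (q : nat) : {set subspace} :=
  [set P : subspace | [exists v : 'rV[F]_3,
     [&& v != 0, [forall i, v 0 i \in GF q] & P == <[v]>%VS]]].

(* The projectivity of PG(2, F) induced by v |-> v *m g. *)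
Definition projectivity (g : 'M[F]_3) (P : subspace) : subspace :=
  (linfun (mulmxr g) @: P)%VS.

(* C is a conic of the subplane B: in suitable homogeneous coordinates, B is
   PG(2, q) and C consists of the points of B on an irreducible conic with
   coefficients in GF(q).  Absolute irreducibility of Q over GF(q) and over F
   is the same. *)
Definition conic_of_subplane (q : nat) (B C : {set subspace}) : Prop :=
  exists g : 'M[F]_3, exists Q : {mpoly F[3]},
    [/\ g \in unitmx,
        B = [set projectivity g P | P in PGsub q],
        Q \is 2.-homog /\ abs_irreducible Q,
        Q \is a mpolyOver 3 (GF q) &
        C = [set projectivity g P | P in PGsub q :&: zeros Q]].

(* (x : y : z) |-> (x^q : y^q : z^q); on linf this is the map defining
   conjugacy.  It does not depend on the vector picked in P. *)
Definition frob_pt (q : nat) (P : subspace) : subspace :=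
  <[map_mx (fun x : F => x ^+ q) (vpick P)]>%VS.

Definition conjugate_points (q : nat) (P R : subspace) : Prop :=
  [/\ P \in linf :\: derivation_set q, R \in linf :\: derivation_set q,
      frob_pt q P = R & frob_pt q R = P].

(* The lines of the affine Hall plane, whose points are those off linf. *)
Definition old_line (q : nat) (L : {set subspace}) : Prop :=
  exists l : {set subspace},
    [/\ l \in lines, l != linf, [disjoint l & derivation_set q] &
        L = affine_part l].

Definition new_line (q : nat) (L : {set subspace}) : Prop :=
  exists B : {set subspace},
    [/\ baer_subplane q B, derivation_set q \subset B & L = affine_part B].

Definition hall_line (q : nat) (L : {set subspace}) : Prop :=
  old_line q L \/ new_line q L.

End Plane.

(* Main.v *)
Require Import Defs.
From mathcomp Require Import all_boot all_order all_algebra all_field.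
From mathcomp Require Import ring zify.
Set Implicit Arguments.
Unset Strict Implicit.
Unset Printing Implicit Defensive.
Import GRing.Theory.
Local Open Scope ring_scope.

(**
Let N(x, y) = (p2 x - p1 y) (r2 x - r1 y), the binary quadratic form that
vanishes at the infinite points (p1 : p2 : 0) and (r1 : r2 : 0) of K.  If both
points are in D, choose their coordinates in GF(q); if they are conjugate,
choose r = p^q.  Either way the coefficients of N lie in GF(q).  On the line at
infinity the equation of K is a multiple of N, and the polar form of N is
non-degenerate because its middle coefficient equals p1 r2 - p2 r1 in
characteristic 2; so a translation removes the linear terms.  The remaining
constant is nonzero, since otherwise the equation splits into two linear forms,
and it is a square, as every element of a finite field of characteristic 2 is.
Hence the affine part of K is N(x - x0, y - y0) = mu^2 with mu != 0
([conic_normal_form]).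

The map (u, v) |-> (x0 + mu u, y0 + mu v) carries the conic N(u, v) = z^2, which
is defined over GF(q), onto K, and PG(2, q) onto a Baer subplane B containing D.
This gives [conic_of_baer].  The points of K in the affine part of B are the
solutions of N(u, v) = 1 over GF(q).  In the coordinates s = p2 u - p1 v and
w = r2 u - r1 v they satisfy w = s^-1, so they are counted by the values of s:
these are the nonzero elements of GF(q) in the first case and, because then
w = s^q, the roots of s^(q+1) = 1 in the second ([card_baer_conic]).

A line of PG(2, q^2) has at most two affine points on K: on sw = mu^2, three
collinear points give a vanishing product of differences of s-coordinates
([splitform_collinear]).  A new line is {(a + lam u, b + lam v)} with u, v in
GF(q) ([subplane_baer] derives this from the axioms of a subplane).  Rescaling
by lam, its intersection with K is N(a' + u, b' + v) = (mu / lam)^2.  Add to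
this equation its image under x |-> x^q: the quadratic terms in (u, v) cancel
since N is defined over GF(q), and what remains is an equation of degree at
most 1 whose linear coefficients are multiples of a'^q - a' and b'^q - b'.  If
one of these is nonzero, the common points are collinear and there are at most
two.  Otherwise a', b' are in GF(q), and a solution forces (mu / lam)^2, hence
mu / lam, into GF(q); then the new line is the affine part of B
([splitform_new_line], [new_line_conic_le2]).
*)

(** * The subfield of order q of the field of order q^2 *)

Section FieldOfOrderQ.

Variables (F : finFieldType) (q h : nat).
Hypotheses (q_pow2 : q = (2 ^ h)%N) (q_gt1 : (1 < q)%N) (cardF : #|F| = (q ^ 2)%N).

Lemma pchar2 : 2%N \in [pchar F].
Proof.
by apply: (@card_finPcharP F 2 (h * 2)) => //; rewrite cardF q_pow2 expnM.
Qed.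

Lemma two_eq0 : 2%:R = 0 :> F. Proof. exact: pcharf0 pchar2. Qed.

Lemma oppr_id (x : F) : - x = x. Proof. exact: oppr_pchar2 pchar2 x. Qed.

Lemma frobD (x y : F) : (x + y) ^+ q = x ^+ q + y ^+ q.
Proof.
apply: exprDn_pchar; rewrite q_pow2; apply: (@sub_in_pnat (2%N : nat_pred)) => [p _|].
  by move/eqP->; exact: pchar2.
exact: pnatX.
Qed.

Lemma frobN (x : F) : (- x) ^+ q = - x ^+ q.
Proof. by rewrite !oppr_id. Qed.

Lemma frobB (x y : F) : (x - y) ^+ q = x ^+ q - y ^+ q.
Proof. by rewrite frobD frobN. Qed.

Lemma frobK (x : F) : x ^+ q ^+ q = x.
Proof. by rewrite -exprM -[(q * q)%N]/(q ^ 2)%N -cardF expf_card. Qed.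

Lemma q_gt0 : (0 < q)%N. Proof. exact: ltnW. Qed.

Lemma GFE (x : F) : (x \in GF F q) = (x ^+ q == x).
Proof. by rewrite inE. Qed.

Lemma GFP (x : F) : reflect (x ^+ q = x) (x \in GF F q).
Proof. by rewrite GFE; exact: eqP. Qed.

Lemma GF0 : 0 \in GF F q.
Proof. by apply/GFP; rewrite expr0n gtn_eqF ?q_gt0. Qed.

Lemma GF1 : 1 \in GF F q.
Proof. by apply/GFP; rewrite expr1n. Qed.

Lemma GFD x y : x \in GF F q -> y \in GF F q -> x + y \in GF F q.
Proof. by move=> /GFP qx /GFP qy; apply/GFP; rewrite frobD qx qy. Qed.

Lemma GFN x : x \in GF F q -> - x \in GF F q.
Proof. by rewrite oppr_id. Qed.

Lemma GFB x y : x \in GF F q -> y \in GF F q -> x - y \in GF F q.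
Proof. by move=> qx qy; apply: GFD => //; apply: GFN. Qed.

Lemma GFM x y : x \in GF F q -> y \in GF F q -> x * y \in GF F q.
Proof. by move=> /GFP qx /GFP qy; apply/GFP; rewrite exprMn qx qy. Qed.

Lemma GFV x : x \in GF F q -> x^-1 \in GF F q.
Proof. by move=> /GFP qx; apply/GFP; rewrite exprVn qx. Qed.

(** Squaring commutes with x |-> x^q and is injective in characteristic 2. *)
Lemma GF_sqr x : x ^+ 2 \in GF F q -> x \in GF F q.
Proof.
move=> /GFP; rewrite -exprM mulnC exprM => /eqP; rewrite -subr_eq0.
have -> : (x ^+ q) ^+ 2 - x ^+ 2 = (x ^+ q - x) ^+ 2 + 2%:R * x * (x ^+ q - x) by ring.
by rewrite two_eq0 !mul0r addr0 sqrf_eq0 subr_eq0 GFE.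
Qed.

Lemma square_root (c : F) : exists x, c = x ^+ 2.
Proof.
exists (c ^+ (2 ^ (h * 2).-1)%N).
have h_gt0 : (0 < h)%N by case: h q_pow2 q_gt1 => // ->.
have -> : (c ^+ (2 ^ (h * 2).-1)) ^+ 2 = c ^+ #|F|.
  by rewrite -exprM -expnSr prednK ?muln_gt0 ?h_gt0 // cardF q_pow2 expnM.
by rewrite expf_card.
Qed.

Lemma card_root_le (f : {poly F}) (n : nat) (A : {set F}) :
  f != 0 -> (size f <= n.+1)%N -> (forall x, x \in A -> root f x) -> (#|A| <= n)%N.
Proof.
move=> f0 szf rA; rewrite cardE -ltnS; apply: leq_trans szf.
by apply: max_poly_roots; rewrite ?enum_uniq //; apply/allP=> x; rewrite mem_enum => /rA.
Qed.

Lemma size_XnDlower (n : nat) (g : {poly F}) :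
  (size g <= n)%N -> ('X^n + g != 0) /\ size ('X^n + g) = n.+1.
Proof.
move=> sg; have sE : size ('X^n + g) = n.+1 by rewrite size_polyDl size_polyXn.
by split=> //; rewrite -size_poly_eq0 sE.
Qed.

Lemma card_fibre_le (aT rT : finType) (f : aT -> rT) (A : {set aT}) (B : {set rT}) (n : nat) :
  (forall x, x \in A -> f x \in B) ->
  (forall y, y \in B -> #|[set x in A | f x == y]| <= n)%N ->
  (#|A| <= #|B| * n)%N.
Proof.
move=> fAB fibre; rewrite -sum1_card (partition_big f (mem B)) //=.
rewrite -sum_nat_const; apply: leq_sum => y By.
by rewrite sum1dep_card; apply: leq_trans (fibre y By); rewrite subset_leq_card //; apply/subsetP=> x; rewrite !inE.
Qed.

(** The polynomials X^q - X - c have at most q roots.  Since (x^q - x)^q =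
x - x^q = x^q - x, the map x |-> x^q - x sends the q^2 elements of F into GF(q);
its fibres have at most q elements, so GF(q) cannot have fewer than q. *)
Lemma card_GF : #|GF F q| = q.
Proof.
have sC (c : F) : (size (- 'X + c%:P : {poly F})%R <= q)%N.
  apply: leq_trans (size_polyD _ _) _; rewrite geq_max; apply/andP; split.
    by rewrite size_polyN size_polyX.
  by apply: leq_trans (size_polyC_leq1 _) _; apply: q_gt0.
have bound (c : F) (A : {set F}) : (forall x, x \in A -> x ^+ q - x = c) -> (#|A| <= q)%N.
  move=> HA; have [p0 sp] := size_XnDlower (sC (- c)).
  apply: (card_root_le p0); rewrite ?sp // => x /HA Hx.
  by rewrite /root !hornerE /= -Hx; apply/eqP; ring.
apply/eqP; rewrite eqn_leq; apply/andP; split.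
  by apply: (bound 0) => x /GFP ->; rewrite subrr.
suff: (q ^ 2 <= #|GF F q| * q)%N by rewrite -mulnn leq_pmul2r ?q_gt0.
rewrite -cardF -cardsT.
apply: (card_fibre_le (f := fun x : F => x ^+ q - x)) => [x _|c _].
  by apply/GFP; rewrite frobB frobK -[RHS]oppr_id opprB.
by apply: (bound c) => x; rewrite inE => /andP[_ /eqP].
Qed.

Lemma card_GF_star : #|[set s in GF F q | s != 0]| = (q - 1)%N.
Proof.
have := cardsD1 0 (GF F q); rewrite GF0 card_GF.
rewrite (_ : GF F q :\ 0 = [set s in GF F q | s != 0]); first by move/esym/(congr1 predn); rewrite subn1.
by apply/setP=> s; rewrite !inE andbC.
Qed.

(** The norm s |-> s^(q+1) maps the q^2 - 1 units of F to the q - 1 units of GF(q),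
with fibres of at most q + 1 elements.  The q - 2 fibres over the units other
than 1 leave at least q + 1 elements for the fibre over 1. *)
Lemma card_norm1 : #|[set s : F | s ^+ q.+1 == 1]| = q.+1.
Proof.
have bound (c : F) (A : {set F}) : (forall x, x \in A -> x ^+ q.+1 = c) -> (#|A| <= q.+1)%N.
  move=> HA; have [|p0 sp] := @size_XnDlower q.+1 (- c)%:P.
    exact: leq_trans (size_polyC_leq1 _) _.
  apply: (card_root_le p0); rewrite ?sp // => x /HA Hx.
  by rewrite /root !hornerE /= -Hx subrr.
set N1 := [set s | _]; apply/eqP; rewrite eqn_leq; apply/andP; split.
  by apply: (bound 1) => x; rewrite inE => /eqP.
have N1_sub : N1 \subset [set~ 0].
  by apply/subsetP=> s; rewrite !inE; apply: contraTneq => ->; rewrite expr0n eq_sym oner_eq0.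
have: (#|[set~ 0%R : F] :\: N1| <= #|[set s in GF F q | s != 0%R] :\ 1%R| * q.+1)%N.
  apply: (card_fibre_le (f := fun s : F => s ^+ q.+1)) => [s|c _].
    rewrite !inE => /andP[-> s0]; rewrite expf_neq0 // andbT /=.
    by rewrite !exprS exprMn frobK mulrC.
  by apply: (bound c) => s; rewrite inE => /andP[_ /eqP].
have := cardsD1 1 [set s in GF F q | s != 0]; rewrite inE GF1 oner_eq0 card_GF_star /=.
have := cardsD [set~ 0 : F] N1; rewrite (setIidPr N1_sub) cardsC1 cardF.
have := subset_leq_card N1_sub; rewrite cardsC1 cardF.
move: #|_| #|_| #|_| => a b c; nia.
Qed.
End FieldOfOrderQ.

(** * Quadratic and affine polynomials in three variables *)

Section TernaryForms.

Definition i0 : 'I_3 := Ordinal (isT : 0 < 3)%N.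
Definition i1 : 'I_3 := Ordinal (isT : 1 < 3)%N.
Definition i2 : 'I_3 := Ordinal (isT : 2 < 3)%N.

Lemma ord3P (P : 'I_3 -> Prop) : P i0 -> P i1 -> P i2 -> forall i, P i.
Proof.
move=> P0 P1 P2 [[|[|[|//]]] lti].
- by rewrite (_ : Ordinal lti = i0) //; apply: val_inj.
- by rewrite (_ : Ordinal lti = i1) //; apply: val_inj.
- by rewrite (_ : Ordinal lti = i2) //; apply: val_inj.
Qed.

Lemma eq_mnm3 (m k : 'X_{1..3}) :
  (m == k) = [&& m i0 == k i0, m i1 == k i1 & m i2 == k i2].
Proof.
apply/eqP/and3P => [-> //|[/eqP E0 /eqP E1 /eqP E2]].
by apply/mnmP; apply: ord3P.
Qed.

Lemma mdeg3 (m : 'X_{1..3}) : mdeg m = (m i0 + m i1 + m i2)%N.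
Proof.
rewrite mdegE !big_ord_recl big_ord0 addn0 addnA.
by congr (_ + _ + _)%N; congr (m _); apply: val_inj.
Qed.

(** The coefficients are those of x^2, xy, y^2, xz, yz and z^2, in this order. *)
Definition quadform (R : comNzRingType) (e t n f g k : R) : {mpoly R[3]} :=
  e%:MP * 'X_[U_(i0) + U_(i0)] + t%:MP * 'X_[U_(i0) + U_(i1)] +
  n%:MP * 'X_[U_(i1) + U_(i1)] + f%:MP * 'X_[U_(i0) + U_(i2)] +
  g%:MP * 'X_[U_(i1) + U_(i2)] + k%:MP * 'X_[U_(i2) + U_(i2)].

Definition affform (R : comNzRingType) (c x y z : R) : {mpoly R[3]} :=
  c%:MP + x%:MP * 'X_i0 + y%:MP * 'X_i1 + z%:MP * 'X_i2.

Lemma mcoeffCX (R : comNzRingType) (c : R) (l m : 'X_{1..3}) :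
  (c%:MP * 'X_[l])@_m = c *+ (l == m).
Proof. by rewrite mcoeffCM mcoeffX mulr_natr. Qed.

Lemma quadform_homog (R : comNzRingType) (e t n f g k : R) :
  quadform e t n f g k \is 2.-homog.
Proof.
by rewrite /quadform; rewrite !rpredD // mul_mpolyC; apply: dhomogZ; rewrite dhomogX /= mdegD !mdeg1.
Qed.

Lemma quadform_eq (R : comNzRingType) (Q : {mpoly R[3]}) : Q \is 2.-homog ->
  exists e t n f g k, Q = quadform e t n f g k.
Proof.
move=> Qh.
exists Q@_(U_(i0) + U_(i0)), Q@_(U_(i0) + U_(i1)), Q@_(U_(i1) + U_(i1)),
  Q@_(U_(i0) + U_(i2)), Q@_(U_(i1) + U_(i2)), Q@_(U_(i2) + U_(i2)).
apply/mpolyP => m; have [m2|m2] := eqVneq (mdeg m) 2; last first.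
  have deg_coeff p : p \is 2.-homog -> p@_m = 0 by move=> hp; exact: dhomog_nemf_coeff hp m2.
  by rewrite !deg_coeff ?quadform_homog.
have [i [j [ij Em]]] : exists i j : 'I_3, (i <= j)%N /\ m = (U_(i) + U_(j))%MM.
  have Em i j : (m == U_(i) + U_(j))%MM = _ := eq_mnm3 _ _.
  suff [i [j /andP[ij /eqP Em']]] : exists i j : 'I_3, (i <= j)%N && (m == U_(i) + U_(j))%MM.
    by exists i, j.
  move: m2; rewrite mdeg3.
  case m0: (m i0) => [|[|[|?]]]; case m1: (m i1) => [|[|[|?]]];
    case m2: (m i2) => [|[|[|?]]] //= _.
  - by exists i2, i2; rewrite eq_mnm3 !mnmDE !mnm1E m0 m1 m2.
  - by exists i1, i2; rewrite eq_mnm3 !mnmDE !mnm1E m0 m1 m2.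
  - by exists i1, i1; rewrite eq_mnm3 !mnmDE !mnm1E m0 m1 m2.
  - by exists i0, i2; rewrite eq_mnm3 !mnmDE !mnm1E m0 m1 m2.
  - by exists i0, i1; rewrite eq_mnm3 !mnmDE !mnm1E m0 m1 m2.
  - by exists i0, i0; rewrite eq_mnm3 !mnmDE !mnm1E m0 m1 m2.
rewrite /quadform !mcoeffD !mcoeffCX Em !eq_mnm3 !mnmDE !mnm1E.
elim/ord3P: i ij {m m2 Em} => //; elim/ord3P: j => //= _; by rewrite ?(addr0, add0r).
Qed.

Lemma affform_eq (R : comNzRingType) (a : {mpoly R[3]}) : (msize a <= 2)%N ->
  exists c x y z, a = affform c x y z.
Proof.
move=> sa; exists a@_0, a@_U_(i0), a@_U_(i1), a@_U_(i2).
have coefC k m : (k%:MP : {mpoly R[3]})@_m = k *+ (m == 0%MM).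
  by rewrite mcoeffC mulr_natr.
apply/mpolyP => m; rewrite /affform !mcoeffD !mcoeffCX coefC.
have [m2|] := leqP 2 (mdeg m).
  have -> : a@_m = 0.
    by apply/eqP; rewrite mcoeff_eq0; apply: msize_mdeg_ge; apply: leq_trans sa m2.
  have neqm k : (mdeg k < 2)%N -> (k == m) = false.
    by move=> k2; apply: contraTF m2 => /eqP <-; rewrite -ltnNge.
  by rewrite !neqm ?mdeg1 // eq_sym neqm ?mdeg0 // !addr0.
rewrite ltnS leq_eqVlt ltnS leqn0 mdeg_eq0 mdeg_eq1 => /orP[/existsP[i /eqP->]|/eqP->].
  rewrite !eq_mnm1 mnm1_eq0.
  by elim/ord3P: i; rewrite /= ?(addr0, add0r).
by rewrite eqxx ![U_(_)%MM == _]mnm1_eq0 !addr0.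
Qed.

Lemma affformM (R : comNzRingType) (c x y z c' x' y' z' : R) :
  affform c x y z * affform c' x' y' z' =
  quadform (x * x') (x * y' + y * x') (y * y') (x * z' + z * x') (y * z' + z * y') (z * z')
  + affform (c * c') (c * x' + x * c') (c * y' + y * c') (c * z' + z * c').
Proof.
rewrite /quadform /affform !mpolyXD !(mpolyCD, mpolyCM); ring.
Qed.

(** These are the four coefficients from which [quadform_irreducible] reads off that
a form with xz and yz terms equal to zero has no factors of degree 1. *)
Lemma mcoeff_quadform_aff (R : comNzRingType) (e t n f g k c x y z : R)
    (p := quadform e t n f g k + affform c x y z) :
  [/\ p@_(U_(i0) + U_(i1)) = t, p@_(U_(i0) + U_(i2)) = f,
      p@_(U_(i1) + U_(i2)) = g & p@_(U_(i2) + U_(i2)) = k].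
Proof.
have aff0 (i j : 'I_3) : (affform c x y z)@_(U_(i) + U_(j)) = 0.
  have neq (l : 'X_{1..3}) : (mdeg l < 2)%N -> (l == U_(i) + U_(j))%MM = false.
    by apply: contraTF => /eqP ->; rewrite mdegD !mdeg1.
  rewrite /affform !mcoeffD !mcoeffCX mcoeffC !neq ?mdeg1 //.
  by rewrite eq_sym neq ?mdeg0 // mulr0 !addr0.
rewrite {}/p; split; rewrite mcoeffD aff0 addr0 /quadform !mcoeffD !mcoeffCX;
  by rewrite !eq_mnm3 !mnmDE !mnm1E /= ?(addr0, add0r).
Qed.

Lemma meval_quadform (R : comNzRingType) (e t n f g k : R) (v : 'I_3 -> R) :
  (quadform e t n f g k).@[v] =
  e * v i0 ^+ 2 + t * (v i0 * v i1) + n * v i1 ^+ 2 + f * (v i0 * v i2) + g * (v i1 * v i2)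
  + k * v i2 ^+ 2.
Proof. by rewrite /quadform !mpolyXD !mevalD !mevalM !mevalC !mevalXU !expr2. Qed.

Lemma map_quadform (R S : comNzRingType) (phi : {rmorphism R -> S}) (e t n f g k : R) :
  map_mpoly phi (quadform e t n f g k) =
  quadform (phi e) (phi t) (phi n) (phi f) (phi g) (phi k).
Proof.
by apply/mpolyP => m; rewrite mcoeff_map_mpoly /quadform !mcoeffD !mcoeffCX !(raddfD phi) !raddfMn.
Qed.

Lemma map_mpoly_idfun (R : comNzRingType) (p : {mpoly R[3]}) : map_mpoly idfun p = p.
Proof. by apply/mpolyP => m; rewrite mcoeff_map_mpoly. Qed.

(** If a factor is constant then, having no constant term, it is 0, and so is the
product. *)
Lemma abs_irreducible_not_product (F : finFieldType) (x y z x' y' z' : F) :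
  ~ abs_irreducible (affform 0 x y z * affform 0 x' y' z').
Proof.
move=> /(_ F idfun); rewrite map_mpoly_idfun => -[sz /(_ _ _ erefl)].
have lin0 (a b d : F) : (msize (affform 0 a b d) <= 1)%N -> affform 0 a b d = 0.
  move/msize1_polyC => ->; rewrite (_ : _@_0 = 0) ?mpolyC0 //.
  by rewrite /affform !mcoeffD mcoeffC !mcoeffCM !mcoeffX !eq_mnm3 !mnm0E !mnm1E /= !mulr0 !mul0r !addr0.
by case=> /lin0 E0; move: sz; rewrite E0 ?mul0r ?mulr0 msize0.
Qed.

Lemma quadform_ext (R : comNzRingType) (e t n f g k e' t' n' f' g' k' : R) :
  (forall x y z, e * x ^+ 2 + t * (x * y) + n * y ^+ 2 + f * (x * z) + g * (y * z) + k * z ^+ 2 =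
     e' * x ^+ 2 + t' * (x * y) + n' * y ^+ 2 + f' * (x * z) + g' * (y * z) + k' * z ^+ 2) ->
  quadform e t n f g k = quadform e' t' n' f' g' k'.
Proof.
move=> E.
have Ee : e = e' by have := E 1 0 0; rewrite !expr0n !expr1n !(mulr0, mul0r, addr0, add0r, mulr1).
have En : n = n' by have := E 0 1 0; rewrite !expr0n !expr1n !(mulr0, mul0r, addr0, add0r, mulr1).
have Ek : k = k' by have := E 0 0 1; rewrite !expr0n !expr1n !(mulr0, mul0r, addr0, add0r, mulr1).
subst e' n' k'.
have -> : t = t'.
  by have := E 1 1 0; rewrite !expr0n !expr1n !(mulr0, mul0r, addr0, add0r, mulr1) => /addIr/addrI.
have -> : f = f'.
  by have := E 1 0 1; rewrite !expr0n !expr1n !(mulr0, mul0r, addr0, add0r, mulr1) => /addIr/addrI.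
have -> // : g = g'.
by have := E 0 1 1; rewrite !expr0n !expr1n !(mulr0, mul0r, addr0, add0r, mulr1) => /addIr/addrI.
Qed.

Lemma irreducible_no_linear_factors (F : finFieldType) (e t n f g k a b c a' b' c' : F) :
  abs_irreducible (quadform e t n f g k) ->
  ~ (forall x y z, e * x ^+ 2 + t * (x * y) + n * y ^+ 2 + f * (x * z) + g * (y * z) + k * z ^+ 2 =
       (a * x + b * y + c * z) * (a' * x + b' * y + c' * z)).
Proof.
move=> irr E; apply: (@abs_irreducible_not_product F a b c a' b' c').
rewrite affformM !(mulr0, mul0r, addr0).
rewrite (_ : affform 0 0 0 0 = 0); last by rewrite /affform mpolyC0 !mul0r !addr0.
rewrite addr0; move: irr; congr (abs_irreducible _); apply: quadform_ext => x y z.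
by rewrite E; ring.
Qed.

(** In a factorization both factors have degree 1; let (x, y, z) and (x', y', z') be
their linear coefficients.  Then z z' = k != 0, x z' = - z x' and y z' = - z y',
so t z z' = (x y' + y x') z z' = - 2 x' y' z^2 = 0.  In characteristic 2 this is
the statement that the partial derivatives t y, t x of the form have (0, 0, 1) as
their only common zero, a point that is not on the conic. *)
Lemma quadform_irreducible (L : fieldType) (e t n k : L) :
  2%:R = 0 :> L -> t != 0 -> k != 0 -> mpoly_irreducible (quadform e t n 0 0 k).
Proof.
move=> two0 t0 k0; set Q := quadform _ _ _ _ _ _.
have coefQ : Q@_(U_(i0) + U_(i1)) = t.
  by rewrite /Q /quadform !mcoeffD !mcoeffCM !mcoeffX !eq_mnm3 !mnmDE !mnm1E /= !mulr0 !mulr1 !addr0 !add0r.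
have Q0 : Q != 0 by apply: contraNneq t0 => Q0; rewrite -coefQ Q0 mcoeff0.
have sQ : msize Q = 3%N.
  by rewrite -(mlead_deg Q0) (dhomog_mf (quadform_homog e t n 0 0 k) (mlead_supp Q0)).
split=> [|a b Eab]; first by rewrite sQ.
have a0 : a != 0 by apply: contraNneq Q0 => a0; rewrite Eab a0 mul0r.
have b0 : b != 0 by apply: contraNneq Q0 => b0; rewrite Eab b0 mulr0.
have := msizeM a0 b0; rewrite -Eab sQ => sab.
have [|sa] := leqP (msize a) 1; first by left.
have [|sb] := leqP (msize b) 1; first by right.
exfalso.
have /affform_eq[c [x [y [z Ea]]]] : (msize a <= 2)%N.
  by move: (msize a) (msize b) sab sa sb => u w; clear; lia.
have /affform_eq[c' [x' [y' [z' Eb]]]] : (msize b <= 2)%N.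
  by move: (msize a) (msize b) sab sa sb => u w; clear; lia.
have [] := mcoeff_quadform_aff e t n 0 0 k 0 0 0 0.
rewrite (_ : affform 0 0 0 0 = 0); last by rewrite /affform mpolyC0 !mul0r !addr0.
rewrite addr0 -/Q Eab Ea Eb affformM.
have [-> -> -> ->] := mcoeff_quadform_aff (x * x') (x * y' + y * x') (y * y') (x * z' + z * x') (y * z' + z * y') (z * z') (c * c') (c * x' + x * c') (c * y' + y * c') (c * z' + z * c').
move=> Et Exz Eyz Ek.
have/eqP[] : t * k != 0 by rewrite mulf_neq0.
rewrite -Et -Ek; transitivity ((x * z' + z * x') * (y' * z) + (y * z' + z * y') * (x' * z) - 2%:R * (x' * y' * z ^+ 2)).
  by ring.
by rewrite Exz Eyz two0 !mul0r addr0 subr0.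
Qed.
End TernaryForms.

(** * Binary quadratic forms with two distinct zeros *)

Section SplitForm.
Variables (F : finFieldType) (q h : nat).
Hypotheses (q_pow2 : q = (2 ^ h)%N) (q_gt1 : (1 < q)%N) (cardF : #|F| = (q ^ 2)%N).
Variables p1 p2 r1 r2 : F.
Hypothesis delta_neq0 : p1 * r2 - p2 * r1 != 0.

(** Up to a scalar, the only binary quadratic form with zeros (p1, p2) and (r1, r2). *)
Definition splitform (x y : F) := (p2 * x - p1 * y) * (r2 * x - r1 * y).

Lemma splitform_coord_inj (x y : F) : p2 * x - p1 * y = 0 -> r2 * x - r1 * y = 0 -> x = 0 /\ y = 0.
Proof.
move=> s0 w0; split; apply: (mulfI delta_neq0); rewrite mulr0.
  by transitivity (p1 * (r2 * x - r1 * y) - r1 * (p2 * x - p1 * y)); [ring | rewrite s0 w0; ring].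
by transitivity (p2 * (r2 * x - r1 * y) - r2 * (p2 * x - p1 * y)); [ring | rewrite s0 w0; ring].
Qed.

Lemma splitform_scale c x y : splitform (c * x) (c * y) = c ^+ 2 * splitform x y.
Proof. by rewrite /splitform; ring. Qed.

(** In the coordinates s = p2 x - p1 y and w = r2 x - r1 y the points satisfy sw = c,
so w = c / s.  Substituting this in the collinearity relation leaves
c (s2 - s1) (s3 - s1) (s3 - s2) = 0. *)
Lemma splitform_collinear (c x1 y1 x2 y2 x3 y3 : F) : c != 0 ->
  splitform x1 y1 = c -> splitform x2 y2 = c -> splitform x3 y3 = c ->
  (x2 - x1) * (y3 - y1) = (x3 - x1) * (y2 - y1) ->
  [\/ (x1, y1) = (x2, y2), (x1, y1) = (x3, y3) | (x2, y2) = (x3, y3)].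
Proof.
move=> c0; rewrite /splitform => N1 N2 N3 col.
set s1 := p2 * x1 - p1 * y1 in N1; set w1 := r2 * x1 - r1 * y1 in N1.
set s2 := p2 * x2 - p1 * y2 in N2; set w2 := r2 * x2 - r1 * y2 in N2.
set s3 := p2 * x3 - p1 * y3 in N3; set w3 := r2 * x3 - r1 * y3 in N3.
(* The map (x, y) |-> (s, w) is linear of determinant p1 r2 - p2 r1. *)
have col' : (s2 - s1) * (w3 - w1) - (s3 - s1) * (w2 - w1) = 0.
  transitivity ((p1 * r2 - p2 * r1) * ((x2 - x1) * (y3 - y1) - (x3 - x1) * (y2 - y1))).
    by rewrite /s1 /s2 /s3 /w1 /w2 /w3; ring.
  by rewrite col subrr mulr0.
have eq_pt x y x' y' : p2 * x - p1 * y = p2 * x' - p1 * y' ->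
    (p2 * x - p1 * y) * (r2 * x - r1 * y) = c ->
    (p2 * x' - p1 * y') * (r2 * x' - r1 * y') = c -> (x, y) = (x', y').
  move=> Es Nx Nx'; have s0 : p2 * x - p1 * y != 0.
    by apply: contra_neq c0 => s0; rewrite -Nx s0 mul0r.
  have Ew : r2 * x - r1 * y = r2 * x' - r1 * y'.
    by apply: (mulfI s0); rewrite Nx Es Nx'.
  have [] := @splitform_coord_inj (x - x') (y - y').
  - by move/eqP: Es; rewrite -subr_eq0 => /eqP <-; ring.
  - by move/eqP: Ew; rewrite -subr_eq0 => /eqP <-; ring.
  by move/eqP; rewrite subr_eq0 => /eqP-> /eqP; rewrite subr_eq0 => /eqP->.
have: c * ((s2 - s1) * (s3 - s1) * (s3 - s2)) = 0.
  transitivity (s1 * s2 * s3 * ((s2 - s1) * (w3 - w1) - (s3 - s1) * (w2 - w1))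
     - (s2 - s1) * (s1 * s2 * (s3 * w3 - c) - s2 * s3 * (s1 * w1 - c))
     + (s3 - s1) * (s1 * s3 * (s2 * w2 - c) - s2 * s3 * (s1 * w1 - c))); first by ring.
  by rewrite col' N1 N2 N3; ring.
move/eqP; rewrite !mulf_eq0 (negPf c0) /= -orbA !subr_eq0 => /or3P[]/eqP E.
- by constructor 1; apply: eq_pt.
- by constructor 2; apply: eq_pt.
- by constructor 3; apply: eq_pt.
Qed.

Let two0 : 2%:R = 0 :> F := two_eq0 q_pow2 cardF.

(** The two sides of p1 r2 - p2 r1 = p2 r1 + p1 r2 differ by 2 p2 r1, which is 0. *)
Lemma polar_neq0 : p2 * r1 + p1 * r2 != 0.
Proof.
have -> : p2 * r1 + p1 * r2 = p1 * r2 - p2 * r1 + 2%:R * (p2 * r1) by ring.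
by rewrite two0 mul0r addr0.
Qed.

(** Eliminating n (resp. e) from the two equations gives
e (p2 r1 + p1 r2) = - t p2 r2 (resp. n (p2 r1 + p1 r2) = - t p1 r1) after division
by p1 r2 - p2 r1. *)
Lemma binary_form_roots (e t n : F) :
  e * p1 ^+ 2 + t * (p1 * p2) + n * p2 ^+ 2 = 0 ->
  e * r1 ^+ 2 + t * (r1 * r2) + n * r2 ^+ 2 = 0 ->
  exists2 k, forall x y, e * x ^+ 2 + t * (x * y) + n * y ^+ 2 = k * splitform x y
    & t = - k * (p2 * r1 + p1 * r2).
Proof.
move=> Ep Er; have d0 := polar_neq0; set d := p2 * r1 + p1 * r2 in d0.
have Ee : e * d = - t * (p2 * r2).
  apply: (mulfI delta_neq0).
  transitivity (r2 ^+ 2 * (e * p1 ^+ 2 + t * (p1 * p2) + n * p2 ^+ 2)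
    - p2 ^+ 2 * (e * r1 ^+ 2 + t * (r1 * r2) + n * r2 ^+ 2) - (p1 * r2 - p2 * r1) * (t * (p2 * r2))).
    by rewrite /d; ring.
  by rewrite Ep Er; ring.
have En : n * d = - t * (p1 * r1).
  apply: (mulfI delta_neq0).
  transitivity (p1 ^+ 2 * (e * r1 ^+ 2 + t * (r1 * r2) + n * r2 ^+ 2)
    - r1 ^+ 2 * (e * p1 ^+ 2 + t * (p1 * p2) + n * p2 ^+ 2) - (p1 * r2 - p2 * r1) * (t * (p1 * r1))).
    by rewrite /d; ring.
  by rewrite Ep Er; ring.
exists (- t / d) => [x y|]; last by rewrite mulNr divfK ?opprK.
apply: (mulfI d0); transitivity ((e * d) * x ^+ 2 + t * d * (x * y) + (n * d) * y ^+ 2); first by ring.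
by rewrite Ee En /splitform /d; field.
Qed.

(** The polar form of the binary form is (p2 r1 + p1 r2) (x y0 + y x0) in
characteristic 2; being non-degenerate, it represents every linear form. *)
Lemma splitform_centre (f g : F) : exists x0 y0, forall x y z,
  splitform x y + f * (x * z) + g * (y * z) =
  splitform (x - x0 * z) (y - y0 * z) - splitform x0 y0 * z ^+ 2.
Proof.
have d0 := polar_neq0; set d := p2 * r1 + p1 * r2 in d0.
exists (g / d), (f / d) => x y z; set x0 := g / d; set y0 := f / d.
have -> : g = x0 * d by rewrite divfK.
have -> : f = y0 * d by rewrite divfK.
rewrite /splitform /d; apply/eqP; rewrite -subr_eq0; apply/eqP.
transitivity (2%:R * (p2 * r2 * x * x0 * z + p1 * r1 * y * y0 * z)); first by ring.
by rewrite two0 mul0r.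
Qed.

(** The difference of the equation of a point and its image under x |-> x^q is
affine in (u, v), with linear coefficients proportional to be = b^q - b and
al = a^q - a.  The three points are not collinear by [splitform_collinear], so
both coefficients vanish. *)
Lemma splitform_new_line (a b d u1 v1 u2 v2 u3 v3 : F) :
  p2 * r2 \in GF F q -> p1 * r1 \in GF F q -> p2 * r1 + p1 * r2 \in GF F q -> d != 0 ->
  u1 \in GF F q -> v1 \in GF F q -> u2 \in GF F q -> v2 \in GF F q -> u3 \in GF F q -> v3 \in GF F q ->
  (u1, v1) != (u2, v2) -> (u1, v1) != (u3, v3) -> (u2, v2) != (u3, v3) ->
  splitform (a + u1) (b + v1) = d -> splitform (a + u2) (b + v2) = d -> splitform (a + u3) (b + v3) = d ->
  [/\ a \in GF F q, b \in GF F q & d \in GF F q].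
Proof.
move=> Fe Fn Ft d0 Fu1 Fv1 Fu2 Fv2 Fu3 Fv3 ne12 ne13 ne23 N1 N2 N3.
pose al := a ^+ q - a; pose be := b ^+ q - b; pose t := p2 * r1 + p1 * r2.
have splitE x y : splitform x y = p2 * r2 * x ^+ 2 - t * (x * y) + p1 * r1 * y ^+ 2.
  by rewrite /splitform /t; ring.
have conj_eq u v : u \in GF F q -> v \in GF F q -> splitform (a + u) (b + v) = d ->
    t * (al * v + be * u) = splitform a b ^+ q - splitform a b - (d ^+ q - d).
  move=> /GFP Fu /GFP Fv <-.
  have frob x y : splitform x y ^+ q = p2 * r2 * (x ^+ q) ^+ 2 - t * (x ^+ q * y ^+ q) + p1 * r1 * (y ^+ q) ^+ 2.
    rewrite splitE {splitE}; move/GFP: Fe; move/GFP: Fn; move/GFP: (Ft : t \in GF F q).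
    move: (p2 * r2) (p1 * r1) @t => e n t' Ft' Fn' Fe'.
    rewrite !(frobD q_pow2 cardF) (frobN q_pow2 cardF) !exprMn Fe' Fn' Ft'.
    by ring.
  rewrite !frob !(frobD q_pow2 cardF) Fu Fv !splitE /al /be.
  apply/eqP; rewrite -subr_eq0; apply/eqP.
  (* The squares only contribute mixed terms with a factor 2. *)
  transitivity (2%:R * (p2 * r2 * u * (a ^+ q - a) + p1 * r1 * v * (b ^+ q - b))); first by ring.
  by rewrite two0 mul0r.
have t0 : t != 0 := polar_neq0.
have lin u v : u \in GF F q -> v \in GF F q -> splitform (a + u) (b + v) = d ->
    al * (v - v1) + be * (u - u1) = 0.
  move=> Fu Fv Nuv; apply: (mulfI t0); rewrite mulr0.
  transitivity (t * (al * v + be * u) - t * (al * v1 + be * u1)); first by ring.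
  by rewrite !conj_eq ?subrr.
have noncol : (u2 - u1) * (v3 - v1) - (u3 - u1) * (v2 - v1) != 0.
  apply/negP; rewrite subr_eq0 => /eqP col.
  have col' : (a + u2 - (a + u1)) * (b + v3 - (b + v1)) = (a + u3 - (a + u1)) * (b + v2 - (b + v1)).
    have B (z w w' : F) : z + w - (z + w') = w - w' by ring.
    by rewrite !B.
  have [] := splitform_collinear d0 N1 N2 N3 col'.
  - by case=> /addrI E1 /addrI E2; rewrite E1 E2 eqxx in ne12.
  - by case=> /addrI E1 /addrI E2; rewrite E1 E2 eqxx in ne13.
  - by case=> /addrI E1 /addrI E2; rewrite E1 E2 eqxx in ne23.
have L2 := lin _ _ Fu2 Fv2 N2; have L3 := lin _ _ Fu3 Fv3 N3.
have al0 : al = 0.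
  apply: (mulfI noncol); rewrite mulr0.
  transitivity ((u2 - u1) * (al * (v3 - v1) + be * (u3 - u1)) - (u3 - u1) * (al * (v2 - v1) + be * (u2 - u1))).
    by ring.
  by rewrite L2 L3 !mulr0 subrr.
have be0 : be = 0.
  apply: (mulfI noncol); rewrite mulr0.
  transitivity ((v3 - v1) * (al * (v2 - v1) + be * (u2 - u1)) - (v2 - v1) * (al * (v3 - v1) + be * (u3 - u1))).
    by ring.
  by rewrite L2 L3 !mulr0 subrr.
have Fa : a \in GF F q by rewrite GFE -subr_eq0 -/al al0.
have Fb : b \in GF F q by rewrite GFE -subr_eq0 -/be be0.
split=> //; rewrite -N1 splitE.
have D := GFD q_pow2 cardF; have B := GFB q_pow2 cardF; have M := @GFM F q.
have Fx := D _ _ Fa Fu1; have Fy := D _ _ Fb Fv1.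
exact: D (B _ _ (M _ _ Fe (M _ _ Fx Fx)) (M _ _ Ft (M _ _ Fx Fy))) (M _ _ Fn (M _ _ Fy Fy)).
Qed.
End SplitForm.

(** * Points and lines in coordinates *)

Section PlaneGeometry.
Variable F : finFieldType.
Implicit Types (x y z : F) (u v w : 'rV[F]_3) (P : subspace F) (l m : {set subspace F}).

Definition vec3 (x y z : F) : 'rV[F]_3 := \row_(i < 3) [:: x; y; z]`_i.

Lemma vec3E0 x y z : vec3 x y z 0 i0 = x. Proof. by rewrite mxE. Qed.
Lemma vec3E1 x y z : vec3 x y z 0 i1 = y. Proof. by rewrite mxE. Qed.
Lemma vec3E2 x y z : vec3 x y z 0 i2 = z. Proof. by rewrite mxE. Qed.
Definition vec3E := (vec3E0, vec3E1, vec3E2).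

Lemma vec3_ext u v : u 0 i0 = v 0 i0 -> u 0 i1 = v 0 i1 -> u 0 i2 = v 0 i2 -> u = v.
Proof. by move=> E0 E1 E2; apply/rowP; apply: ord3P. Qed.

Lemma vec3_eta v : v = vec3 (v 0 i0) (v 0 i1) (v 0 i2).
Proof. by apply: vec3_ext; rewrite vec3E. Qed.

Lemma vec3D x y z x' y' z' : vec3 x y z + vec3 x' y' z' = vec3 (x + x') (y + y') (z + z').
Proof. by apply: vec3_ext; rewrite mxE !vec3E. Qed.

Lemma vec3Z k x y z : k *: vec3 x y z = vec3 (k * x) (k * y) (k * z).
Proof. by apply: vec3_ext; rewrite mxE !vec3E. Qed.

Lemma vec3_inj x y z x' y' z' : vec3 x y z = vec3 x' y' z' -> [/\ x = x', y = y' & z = z'].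
Proof.
by move/rowP=> E; split; [have := E i0 | have := E i1 | have := E i2]; rewrite !vec3E.
Qed.

Lemma vec3_eq0 x y z : (vec3 x y z == 0) = [&& x == 0, y == 0 & z == 0].
Proof.
apply/eqP/and3P => [/rowP E|[/eqP-> /eqP-> /eqP->]].
  by split; apply/eqP; [have := E i0 | have := E i1 | have := E i2]; rewrite vec3E mxE.
by apply: vec3_ext; rewrite vec3E mxE.
Qed.

Lemma vec3z1_neq0 x y : vec3 x y 1 != 0.
Proof. by rewrite vec3_eq0 oner_eq0 !andbF. Qed.

Lemma vline_points v : v != 0 -> <[v]>%VS \in points F.
Proof. by move=> v0; rewrite inE dim_vline v0. Qed.

Lemma pointsP P : P \in points F -> exists2 v, v != 0 & P = <[v]>%VS.
Proof.
rewrite inE => /eqP dP; exists (vpick P); first by rewrite vpick0 -dimv_eq0 dP.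
apply/esym/eqP; rewrite eqEdim dP dim_vline vpick0 -dimv_eq0 dP leqnn andbT.
by rewrite -memvE memv_pick.
Qed.

Lemma vline_eqP u v : u != 0 -> reflect (exists2 k, k != 0 & u = k *: v) (<[u]> == <[v]>)%VS.
Proof.
move=> u0; apply: (iffP idP) => [/eqP E|[k k0 ->]].
  have /vlineP[k Ek] : u \in <[v]>%VS by rewrite -E memv_line.
  by exists k => //; apply: contraNneq u0 => k0; rewrite Ek k0 scale0r.
rewrite eqEsubv -!memvE; apply/andP; split; apply/vlineP; first by exists k.
by exists k^-1; rewrite scalerA mulVf ?scale1r.
Qed.

Lemma vline_scale k v : k != 0 -> <[k *: v]>%VS = <[v]>%VS.
Proof.
move=> k0; have [->|v0] := eqVneq v 0; first by rewrite scaler0.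
by apply/eqP/vline_eqP; [rewrite scaler_eq0 negb_or k0 | exists k].
Qed.

Lemma pt_affine_inj x y x' y' : pt x y 1 = pt x' y' 1 -> x = x' /\ y = y'.
Proof.
move/eqP/(vline_eqP _ (vec3z1_neq0 x y)) => [k _ E].
have [Ex Ey Ez] : [/\ x = k * x', y = k * y' & 1 = k * 1].
  by apply: vec3_inj; rewrite -vec3Z -E.
by move: Ez; rewrite mulr1 Ex Ey => <-; rewrite !mul1r.
Qed.

Lemma dim_join u v : u != 0 -> v != 0 -> <[u]>%VS != <[v]>%VS ->
  \dim (<[u]> + <[v]>)%VS = 2%N.
Proof.
move=> u0 v0 uv; rewrite dimv_disjoint_sum ?dim_vline ?u0 ?v0 //.
apply/eqP; rewrite -subv0; apply/subvP => w; rewrite memv_cap memv0.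
case/andP=> /vlineP[a ->] /vlineP[b E]; rewrite scaler_eq0 (negPf u0) orbF.
apply: contraNT uv => a0; apply/eqP.
rewrite -(vline_scale u a0) E vline_scale //.
by apply: contraNneq u0 => b0; move/eqP: E; rewrite b0 scale0r scaler_eq0 (negPf a0).
Qed.

Lemma line_of_span u v : u != 0 -> v != 0 -> <[u]>%VS != <[v]>%VS ->
  line_of (<[u]> + <[v]>)%VS \in lines F.
Proof. by move=> u0 v0 uv; apply/imsetP; exists (<[u]> + <[v]>)%VS; rewrite // inE dim_join. Qed.

Lemma mem_line_of (W : subspace F) w : w != 0 -> (<[w]>%VS \in line_of W) = (w \in W).
Proof. by move=> w0; rewrite inE vline_points. Qed.

Lemma mem_spanP u v w : reflect (exists s t, w = s *: u + t *: v) (w \in <[u]> + <[v]>)%VS.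
Proof.
apply: (iffP memv_addP) => [[_ /vlineP[s ->] [_ /vlineP[t ->] ->]]|[s [t ->]]]; first by exists s, t.
by exists (s *: u); rewrite ?memvZ ?memv_line //; exists (t *: v); rewrite ?memvZ ?memv_line.
Qed.

Lemma line_through u v l : u != 0 -> v != 0 -> <[u]>%VS != <[v]>%VS -> l \in lines F ->
  <[u]>%VS \in l -> <[v]>%VS \in l -> l = line_of (<[u]> + <[v]>)%VS.
Proof.
move=> u0 v0 uv /imsetP[W]; rewrite inE => /eqP dW ->; rewrite !mem_line_of // => uW vW.
congr line_of; apply/esym/eqP; rewrite eqEdim dW dim_join // leqnn andbT.
by apply/subvP => w /mem_spanP[s [t ->]]; rewrite memvD ?memvZ.
Qed.

Lemma i2_max : ord_max = i2. Proof. exact: val_inj. Qed.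

Lemma vline_neq u v (i j : 'I_3) : u 0 i * v 0 j != u 0 j * v 0 i -> <[u]>%VS != <[v]>%VS.
Proof.
apply: contra_neqN => /eqP E.
have /vlineP[k ->] : u \in <[v]>%VS by rewrite -E memv_line.
by rewrite !mxE mulrAC.
Qed.

Lemma lin_indep u v s t : u != 0 -> v != 0 -> <[u]>%VS != <[v]>%VS ->
  s *: u + t *: v = 0 -> s = 0 /\ t = 0.
Proof.
move=> u0 v0 uv E.
have s0 : s = 0.
  apply: contraNeq uv => s0; apply/vline_eqP => //; exists (- (t / s)).
    rewrite oppr_eq0 mulf_neq0 ?invr_eq0 //; apply: contraNneq u0 => t0.
    by move/eqP: E; rewrite t0 scale0r addr0 scaler_eq0 (negPf s0).
  apply: (scalerI s0); rewrite scalerA mulrN mulrC divfK // scaleNr.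
  by apply/eqP; rewrite -addr_eq0 E.
split=> //; apply/eqP; move/eqP: E.
by rewrite s0 scale0r add0r scaler_eq0 (negPf v0) orbF.
Qed.

Lemma lin_indep_eq u v s t s' t' : u != 0 -> v != 0 -> <[u]>%VS != <[v]>%VS ->
  s *: u + t *: v = s' *: u + t' *: v -> s = s' /\ t = t'.
Proof.
move=> u0 v0 uv /eqP; rewrite -subr_eq0 opprD addrACA -!scalerBl => /eqP /lin_indep[] //.
by move=> /eqP; rewrite subr_eq0 => /eqP-> /eqP; rewrite subr_eq0 => /eqP->.
Qed.

Lemma mem_linf v : v != 0 -> (<[v]>%VS \in linf F) = (v 0 i2 == 0).
Proof.
move=> v0; rewrite inE vline_points //= i2_max; apply/forallP/idP => [/(_ v)|v2 w].
  by rewrite memv_line.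
by apply/implyP => /vlineP[k ->]; rewrite mxE (eqP v2) mulr0.
Qed.

Lemma pt_affine x y : pt x y 1 \in points F :\: linf F.
Proof. by rewrite inE vline_points ?mem_linf ?vec3z1_neq0 // vec3E oner_eq0. Qed.

Lemma affineP P : P \in points F :\: linf F -> exists x y, P = pt x y 1.
Proof.
rewrite inE => /andP[Pinf /pointsP[v v0 EP]]; move: Pinf; rewrite {}EP mem_linf // => v2.
exists ((v 0 i2)^-1 * v 0 i0), ((v 0 i2)^-1 * v 0 i1).
rewrite /pt -/(vec3 _ _ _) -(mulVf v2) -vec3Z vline_scale ?invr_eq0 //.
by rewrite -vec3_eta.
Qed.

Lemma mem_zeros (e t n f g k : F) v : v != 0 ->
  (<[v]>%VS \in zeros (quadform e t n f g k)) = ((quadform e t n f g k).@[v 0] == 0).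
Proof.
move=> v0; rewrite inE vline_points //=; apply/forallP/idP => [/(_ v)|/eqP v2 w].
  by rewrite memv_line.
apply/implyP => /vlineP[s ->]; apply/eqP.
transitivity (s ^+ 2 * (quadform e t n f g k).@[v 0]); last by rewrite v2 mulr0.
by rewrite !meval_quadform !mxE; ring.
Qed.

Lemma mem_zeros_pt (e t n f g k x y z : F) : (x, y, z) != (0, 0, 0) ->
  (pt x y z \in zeros (quadform e t n f g k)) =
  (e * x ^+ 2 + t * (x * y) + n * y ^+ 2 + f * (x * z) + g * (y * z) + k * z ^+ 2 == 0).
Proof.
move=> xyz; rewrite mem_zeros ?meval_quadform ?vec3E //.
by rewrite vec3_eq0; move: xyz; rewrite !xpair_eqE -andbA.
Qed.

Lemma derivP q P : reflect (exists x y, [/\ x \in GF F q, y \in GF F q, (x, y) != (0, 0) & P = pt x y 0])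
  (P \in derivation_set F q).
Proof.
rewrite inE; apply: (iffP exists_inP) => [[x Fx /exists_inP[y Fy /andP[xy /eqP ->]]]|[x [y [Fx Fy xy ->]]]].
  by exists x, y.
by exists x => //; apply/exists_inP; exists y => //; rewrite xy eqxx.
Qed.

Lemma three_distinct (T : finType) (A : {set T}) : (2 < #|A|)%N ->
  exists a b c, [/\ [/\ a \in A, b \in A & c \in A], a != b, a != c & b != c].
Proof.
move=> A2; have /set0Pn[a Aa] : A != set0 by rewrite -card_gt0; lia.
have := cardsD1 a A; rewrite Aa => cA.
have /set0Pn[b Ab] : A :\ a != set0 by rewrite -card_gt0; lia.
have := cardsD1 b (A :\ a); rewrite Ab => cAa.
have /set0Pn[c] : A :\ a :\ b != set0 by rewrite -card_gt0; lia.
move: Ab; rewrite !inE => /andP[ba Ab] /and3P[cb ca Ac].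
by exists a, b, c; rewrite Aa Ab Ac eq_sym ba eq_sym ca eq_sym cb.
Qed.

Lemma linf_line : linf F \in lines F.
Proof.
pose e1 : 'rV[F]_3 := vec3 1 0 0; pose e2 : 'rV[F]_3 := vec3 0 1 0.
have e10 : e1 != 0 by rewrite vec3_eq0 oner_eq0.
have e20 : e2 != 0 by rewrite vec3_eq0 oner_eq0 andbF.
have e12 : <[e1]>%VS != <[e2]>%VS.
  by apply: (@vline_neq _ _ i0 i1); rewrite !vec3E mulr1 mul0r oner_eq0.
rewrite (_ : linf F = line_of (<[e1]> + <[e2]>)%VS); first exact: line_of_span.
apply/setP => P; have [/pointsP[w w0 ->]|/negPf Pp] := boolP (P \in points F); last first.
  by rewrite /linf /line_of [LHS]in_set [RHS]in_set Pp.
rewrite mem_linf // mem_line_of //; apply/eqP/mem_spanP => [w2|[s [t ->]]].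
  exists (w 0 i0), (w 0 i1); rewrite !vec3Z vec3D {1}(vec3_eta w) w2.
  by congr vec3; ring.
by rewrite !mxE /=; ring.
Qed.

(** If the determinant vanishes, the two coordinate vectors are proportional. *)
Lemma infinite_points_det (p1 p2 r1 r2 : F) : vec3 r1 r2 0 != 0 ->
  pt p1 p2 0 != pt r1 r2 0 -> vec3 p1 p2 0 != 0 -> p1 * r2 - p2 * r1 != 0.
Proof.
move=> r0 + p0; apply: contraNneq => /eqP; rewrite subr_eq0 => /eqP E.
have [r10|r10] := eqVneq r1 0.
  have r20 : r2 != 0 by apply: contraNneq r0 => r20; rewrite r10 r20 vec3_eq0 eqxx.
  have p10 : p1 = 0 by apply: (mulIf r20); rewrite E r10 mul0r mulr0.
  apply/(vline_eqP _ p0); exists (p2 / r2).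
    by rewrite mulf_neq0 ?invr_eq0 //; apply: contraNneq p0 => p20; rewrite p10 p20 vec3_eq0 eqxx.
  by rewrite vec3Z p10 r10 !mulr0 divfK.
apply/(vline_eqP _ p0); exists (p1 / r1).
  rewrite mulf_neq0 ?invr_eq0 //; apply: contraNneq p0 => p10; rewrite p10 vec3_eq0 eqxx andbT /=.
  by move/eqP: E; rewrite p10 mul0r eq_sym mulf_eq0 (negPf r10) orbF.
by rewrite vec3Z mulr0 divfK // mulrAC E mulfK.
Qed.

Lemma three_affine (A : {set subspace F}) : A \subset points F :\: linf F -> (2 < #|A|)%N ->
  exists x1 y1 x2 y2 x3 y3, [/\ [/\ pt x1 y1 1 \in A, pt x2 y2 1 \in A & pt x3 y3 1 \in A],
    (x1, y1) != (x2, y2), (x1, y1) != (x3, y3) & (x2, y2) != (x3, y3)].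
Proof.
move=> /subsetP Aaff /three_distinct[P1 [P2 [P3 [[A1 A2 A3] n12 n13 n23]]]].
have [x1 [y1 E1]] := affineP (Aaff _ A1); have [x2 [y2 E2]] := affineP (Aaff _ A2).
have [x3 [y3 E3]] := affineP (Aaff _ A3).
exists x1, y1, x2, y2, x3, y3; rewrite -E1 -E2 -E3; split=> //.
- by apply: contraNneq n12 => -[Ex Ey]; rewrite E1 E2 Ex Ey.
- by apply: contraNneq n13 => -[Ex Ey]; rewrite E1 E3 Ex Ey.
- by apply: contraNneq n23 => -[Ex Ey]; rewrite E2 E3 Ex Ey.
Qed.

End PlaneGeometry.

(** * Images of PG(2, q) are subplanes of order q *)

Section BaerSubplanes.
Variables (F : finFieldType) (q h : nat).
Hypotheses (q_pow2 : q = (2 ^ h)%N) (q_gt1 : (1 < q)%N) (cardF : #|F| = (q ^ 2)%N).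
Implicit Types (u v w : 'rV[F]_3) (P : subspace F) (l m : {set subspace F}).

Definition GFvec v := [forall i, v 0 i \in GF F q].
(** The semilinear map whose fixed vectors are those with coordinates in GF(q). *)
Definition frobv v : 'rV[F]_3 := map_mx (fun x => x ^+ q) v.

Lemma GFvecP v : reflect (frobv v = v) (GFvec v).
Proof.
apply: (iffP forallP) => [Fv|/rowP Ev i].
  by apply/rowP => i; rewrite mxE; apply/GFP.
by apply/GFP; have := Ev i; rewrite mxE.
Qed.

Lemma frobv_lin s t u v : frobv (s *: u + t *: v) = s ^+ q *: frobv u + t ^+ q *: frobv v.
Proof. by apply/rowP => i; rewrite !mxE (frobD q_pow2 cardF) !exprMn. Qed.

Lemma GFvec_lin s t u v : s \in GF F q -> t \in GF F q -> GFvec u -> GFvec v ->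
  GFvec (s *: u + t *: v).
Proof.
by move=> /GFP Fs /GFP Ft /GFvecP Fu /GFvecP Fv; apply/GFvecP; rewrite frobv_lin Fs Ft Fu Fv.
Qed.

(** Dividing by a nonzero coordinate makes that coordinate 1, and then the factor of
proportionality with the image is 1 too. *)
Lemma frob_stable_point v k : v != 0 -> frobv v = k *: v ->
  exists w, [/\ w != 0, GFvec w & <[v]>%VS = <[w]>%VS].
Proof.
move=> v0 Ev; have [i vi] : exists i, v 0 i != 0.
  apply/existsP; apply: contraNT v0; rewrite negb_exists => /forallP H.
  by apply/eqP/rowP => i; rewrite mxE; apply/eqP/negbNE.
have vi' : (v 0 i)^-1 != 0 by rewrite invr_eq0.
exists ((v 0 i)^-1 *: v); split; last by rewrite vline_scale.
  by rewrite scaler_eq0 negb_or vi'.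
have Evj j : v 0 j ^+ q = k * v 0 j by have /rowP/(_ j) := Ev; rewrite !mxE.
apply/forallP => j; apply/GFP; rewrite mxE exprMn exprVn !Evj invfM mulrACA mulVf ?mul1r //.
by apply: contra_neq (expf_neq0 q vi) => k0; rewrite Evj k0 mul0r.
Qed.

Variable g : 'M[F]_3.
Hypothesis g_unit : g \in unitmx.

Lemma mulmx_unit_inj : injective (fun v : 'rV[F]_3 => v *m g).
Proof. exact: (can_inj (mulmxK g_unit)). Qed.

Lemma mulmx_unit_eq0 v : (v *m g == 0) = (v == 0).
Proof. by rewrite -(inj_eq mulmx_unit_inj) mul0mx. Qed.

Lemma vline_mulmx_eq u v : u != 0 -> (<[u *m g]> == <[v *m g]>)%VS = (<[u]> == <[v]>)%VS.
Proof.
move=> u0; have ug0 : u *m g != 0 by rewrite mulmx_unit_eq0.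
apply/(vline_eqP _ ug0)/(vline_eqP _ u0) => -[k k0 E]; exists k => //.
  by apply: mulmx_unit_inj; rewrite /= E scalemxAl.
by rewrite E scalemxAl.
Qed.

Lemma projectivity_vline v : projectivity g <[v]>%VS = <[v *m g]>%VS.
Proof. by rewrite /projectivity limg_line lfunE. Qed.

Definition baer : {set subspace F} := [set projectivity g P | P in PGsub F q].

Lemma PGsubP P : reflect (exists v, [/\ v != 0, GFvec v & P = <[v]>%VS]) (P \in PGsub F q).
Proof.
by rewrite inE; apply: (iffP existsP) => [[v /and3P[v0 Fv /eqP ->]]|[v [v0 Fv ->]]]; exists v => //; apply/and3P.
Qed.

Lemma baerP P : reflect (exists v, [/\ v != 0, GFvec v & P = <[v *m g]>%VS]) (P \in baer).
Proof.
apply: (iffP imsetP) => [[_ /PGsubP[v [v0 Fv ->]] ->]|[v [v0 Fv ->]]].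
  by exists v; rewrite projectivity_vline.
by exists <[v]>%VS; rewrite ?projectivity_vline //; apply/PGsubP; exists v.
Qed.

Lemma secantP l : l \in secants baer -> exists u v,
  [/\ [/\ u != 0, v != 0, GFvec u & GFvec v], <[u]>%VS != <[v]>%VS &
      l = line_of (<[u *m g]> + <[v *m g]>)%VS].
Proof.
rewrite inE => /andP[ll /card_gt1P[P [R [/setIP[Pl /baerP[u [u0 Fu EP]]] /setIP[Rl /baerP[v [v0 Fv ER]]] PR]]]].
move: Pl Rl PR; rewrite EP ER => Pl Rl PR.
exists u, v; rewrite -vline_mulmx_eq //; split=> //.
by apply: line_through; rewrite ?mulmx_unit_eq0.
Qed.

Lemma mem_baer_line u v w : w != 0 ->
  (<[w *m g]>%VS \in line_of (<[u *m g]> + <[v *m g]>)%VS) = (w \in <[u]> + <[v]>)%VS.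
Proof.
move=> w0; rewrite mem_line_of ?mulmx_unit_eq0 //.
apply/mem_spanP/mem_spanP => -[s [t E]]; exists s, t.
  by apply: mulmx_unit_inj; rewrite /= E mulmxDl !scalemxAl.
by rewrite E mulmxDl !scalemxAl.
Qed.

(** The points of the line with coordinates in GF(q) are v and u + t v for t in GF(q):
applying x |-> x^q to w = s u + t v shows that s and t are in GF(q) when u, v and
w have coordinates there. *)
Lemma card_baer_secant u v : u != 0 -> v != 0 -> GFvec u -> GFvec v -> <[u]>%VS != <[v]>%VS ->
  #|line_of (<[u *m g]> + <[v *m g]>)%VS :&: baer| = q.+1.
Proof.
move=> u0 v0 Fu Fv uv.
pose pnt t : subspace F := <[(u + t *: v) *m g]>%VS.
have ut0 t : u + t *: v != 0.
  apply/eqP => E; have [] := @lin_indep _ u v 1 t u0 v0 uv; first by rewrite scale1r.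
  by move/eqP; rewrite oner_eq0.
have -> : line_of (<[u *m g]> + <[v *m g]>)%VS :&: baer = (<[v *m g]>%VS : subspace F) |: [set pnt t | t in GF F q].
  apply/setP => P; rewrite in_setI in_setU1; apply/andP/orP => [[Pl /baerP[w [w0 Fw EP]]]|].
    have : w \in (<[u]> + <[v]>)%VS by rewrite -mem_baer_line // -EP.
    case/mem_spanP => s [t Ew].
    have [Fs Ft] : s ^+ q = s /\ t ^+ q = t.
      apply: (lin_indep_eq u0 v0 uv); rewrite -Ew -[RHS](GFvecP _ Fw) Ew frobv_lin.
      by rewrite (GFvecP _ Fu) (GFvecP _ Fv).
    have [s0|s0] := eqVneq s 0.
      left; rewrite EP Ew s0 scale0r add0r -scalemxAl vline_scale //.
      by apply: contraNneq w0 => t0; rewrite Ew s0 t0 !scale0r addr0.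
    right; apply/imsetP; exists (t / s); first by rewrite GFM ?GFV //; apply/GFP.
    rewrite EP /pnt -(vline_scale ((u + t / s *: v) *m g) s0) scalemxAl scalerDr scalerA.
    by rewrite mulrC divfK // Ew.
  have key w : w != 0 -> GFvec w -> w \in (<[u]> + <[v]>)%VS -> P = <[w *m g]>%VS ->
      P \in line_of (<[u *m g]> + <[v *m g]>)%VS /\ P \in baer.
    move=> w0 Fw wuv EP; split; last by apply/baerP; exists w.
    by rewrite EP mem_baer_line.
  case=> [/eqP EP|/imsetP[t Ft EP]].
    by apply: (key v) => //; apply/mem_spanP; exists 0, 1; rewrite scale0r add0r scale1r.
  apply: (key (u + t *: v)) => //; last by apply/mem_spanP; exists 1, t; rewrite scale1r.
  by rewrite -[u]scale1r; apply: GFvec_lin => //; apply: GF1.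
rewrite cardsU1 card_in_imset ?card_GF //; last first.
  move=> t t' _ _ /eqP; rewrite vline_mulmx_eq // => /(vline_eqP _ (ut0 t))[k _].
  rewrite -{1}[u]scale1r scalerDr scalerA => /(lin_indep_eq u0 v0 uv)[<-].
  by rewrite mul1r.
rewrite (card_GF q_pow2 q_gt1 cardF) (_ : _ \notin _) //.
apply/imsetP => -[t _ /eqP]; rewrite vline_mulmx_eq // => /(vline_eqP _ v0)[k k0].
rewrite scalerDr scalerA -{1}[v]scale1r -[LHS]add0r -{1}(scale0r u) => /(lin_indep_eq u0 v0 uv)[E].
by rewrite -E eqxx in k0.
Qed.

(** Both lines, pulled back by g, are spanned by vectors with coordinates in GF(q),
hence stable under x |-> x^q; so is their common point, which therefore has
coordinates in GF(q). *)
Lemma baer_secants_meet l m : l \in secants baer -> m \in secants baer -> l != m ->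
  exists2 P, P \in baer & P \in l :&: m.
Proof.
move=> /secantP[u [v [[u0 v0 Fu Fv] uv El]]] /secantP[u' [v' [[u0' v0' Fu' Fv'] uv' Em]]] lm.
pose W := (<[u]> + <[v]>)%VS; pose W' := (<[u']> + <[v']>)%VS.
have dW : \dim W = 2%N by apply: dim_join.
have dW' : \dim W' = 2%N by apply: dim_join.
have dcap : \dim (W :&: W') = 1%N.
  have := dimv_sum_cap W W'; rewrite dW dW' => dsum.
  have := dimvS (subvf (W + W')%VS); rewrite dimvf dim_matrix mul1r => dle.
  have dcap2 : (\dim (W :&: W') < 2)%N.
    rewrite ltnNge; apply: contraNN lm => dge; rewrite El Em.
    have EW : (W :&: W')%VS = W by apply/eqP; rewrite eqEdim capvSl dW.
    have EW' : (W :&: W')%VS = W' by apply/eqP; rewrite eqEdim capvSr dW'.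
    have WW' : W = W' by rewrite -EW EW'.
    apply/eqP/setP => P; have [/pointsP[w w0 ->]|/negPf Pp] := boolP (P \in points F).
      have w0' : w *m invmx g != 0 by rewrite -mulmx_unit_eq0 mulmxKV.
      by rewrite -(mulmxKV g_unit w) !mem_baer_line // -/W -/W' WW'.
    by rewrite /line_of [LHS]in_set [RHS]in_set Pp.
  by move: dsum dle dcap2; move: (\dim _) (\dim _) => a b; clear; lia.
pose x := vpick (W :&: W').
have x0 : x != 0 by rewrite vpick0 -dimv_eq0 dcap.
have xcap : x \in (W :&: W')%VS by apply: memv_pick.
have capE : (W :&: W')%VS = <[x]>%VS.
  by apply/esym/eqP; rewrite eqEdim dcap dim_vline x0 -memvE xcap.
have stab u1 v1 y : GFvec u1 -> GFvec v1 -> y \in (<[u1]> + <[v1]>)%VS -> frobv y \in (<[u1]> + <[v1]>)%VS.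
  move=> /GFvecP F1 /GFvecP F2 /mem_spanP[s [t ->]].
  by rewrite frobv_lin F1 F2; apply/mem_spanP; exists (s ^+ q), (t ^+ q).
have /vlineP[k Ek] : frobv x \in <[x]>%VS.
  rewrite -capE; move: xcap; rewrite !memv_cap => /andP[xW xW'].
  by rewrite !stab.
have [w [w0 Fw Ew]] := frob_stable_point x0 Ek.
have wcap : w \in (W :&: W')%VS by rewrite capE Ew memv_line.
exists (<[w *m g]>%VS); first by apply/baerP; exists w.
by rewrite inE El Em !mem_baer_line // -memv_cap.
Qed.

(** The images of (1:0:0), (0:1:0), (0:0:1) and (1:1:1): a line through three of them
would contain the fourth and be the whole plane. *)
Lemma baer_quadrangle : exists S : {set subspace F},
  [/\ S \subset baer, #|S| = 4%N & forall l, l \in lines F -> (#|S :&: l| <= 2)%N].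
Proof.
pose e1 : 'rV[F]_3 := vec3 1 0 0; pose e2 : 'rV[F]_3 := vec3 0 1 0.
pose e3 : 'rV[F]_3 := vec3 0 0 1; pose e4 : 'rV[F]_3 := vec3 1 1 1.
pose s : seq (subspace F) := [seq <[v *m g]>%VS | v <- [:: e1; e2; e3; e4]].
have us : uniq s.
  have neq u v (i j : 'I_3) : u != 0 -> u 0 i * v 0 j != u 0 j * v 0 i -> <[u *m g]>%VS != <[v *m g]>%VS.
    by move=> u0 uv; rewrite vline_mulmx_eq //; apply: vline_neq uv.
  have n12 : <[e1 *m g]>%VS != <[e2 *m g]>%VS.
    by apply: (neq _ _ i0 i1); rewrite /e1 /e2 /e3 /e4 ?vec3_eq0 ?vec3E ?(mulr0, mulr1, mul0r) oner_eq0.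
  have n13 : <[e1 *m g]>%VS != <[e3 *m g]>%VS.
    by apply: (neq _ _ i0 i2); rewrite /e1 /e2 /e3 /e4 ?vec3_eq0 ?vec3E ?(mulr0, mulr1, mul0r) oner_eq0.
  have n14 : <[e1 *m g]>%VS != <[e4 *m g]>%VS.
    by apply: (neq _ _ i0 i1); rewrite /e1 /e2 /e3 /e4 ?vec3_eq0 ?vec3E ?(mulr0, mulr1, mul0r) oner_eq0.
  have n23 : <[e2 *m g]>%VS != <[e3 *m g]>%VS.
    by apply: (neq _ _ i1 i2); rewrite /e1 /e2 /e3 /e4 ?vec3_eq0 ?vec3E ?(mulr0, mulr1, mul0r) oner_eq0 ?andbF.
  have n24 : <[e2 *m g]>%VS != <[e4 *m g]>%VS.
    by apply: (neq _ _ i1 i0); rewrite /e1 /e2 /e3 /e4 ?vec3_eq0 ?vec3E ?(mulr0, mulr1, mul0r) oner_eq0 ?andbF.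
  have n34 : <[e3 *m g]>%VS != <[e4 *m g]>%VS.
    by apply: (neq _ _ i2 i0); rewrite /e1 /e2 /e3 /e4 ?vec3_eq0 ?vec3E ?(mulr0, mulr1, mul0r) oner_eq0 ?andbF.
  by rewrite /= !in_cons !in_nil !negb_or n12 n13 n14 n23 n24 n34.
have card_s (t : seq (subspace F)) : uniq t -> #|[set P in t]| = size t.
  by move=> ut; rewrite cardsE; apply/card_uniqP.
exists [set P in s]; split=> [||l /imsetP[W]].
- apply/subsetP => P; rewrite inE => /mapP[v vs ->]; apply/baerP; exists v.
  have F0 : 0 \in GF F q := GF0 F q_gt1; have F1 : 1 \in GF F q := GF1 F q.
  by move: vs; rewrite !inE => /or4P[]/eqP->; rewrite vec3_eq0 ?oner_eq0 ?andbF;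
    split=> //; apply/forallP; apply: ord3P; rewrite vec3E.
- by rewrite card_s // size_map.
rewrite inE => /eqP dW ->.
have -> : [set P in s] :&: line_of W = [set P in [seq P <- s | P \in line_of W]].
  by apply/setP => P; rewrite in_setI andbC [RHS]in_set mem_filter; congr (_ && _); rewrite in_set.
rewrite card_s ?filter_uniq // size_filter /s /=.
have mW v : v != 0 -> (<[v *m g]>%VS \in line_of W) = (v *m g \in W).
  by move=> v0; rewrite mem_line_of ?mulmx_unit_eq0.
rewrite !mW ?vec3_eq0 ?oner_eq0 ?andbF //.
have nfull : ~ [/\ e1 *m g \in W, e2 *m g \in W & e3 *m g \in W].
  move=> [W1 W2 W3]; suff: (fullv <= W)%VS.
    by move/dimvS; rewrite dW dimvf dim_matrix mul1r.
  apply/subvP => v _; rewrite -(mulmxKV g_unit v); set w := v *m _.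
  have -> : w = w 0 i0 *: e1 + w 0 i1 *: e2 + w 0 i2 *: e3.
    rewrite !vec3Z !vec3D {1}(vec3_eta w); congr vec3; ring.
  by rewrite !mulmxDl -!scalemxAl !memvD ?memvZ.
have e4E : e4 *m g = e1 *m g + e2 *m g + e3 *m g.
  by rewrite -!mulmxDl !vec3D; congr (vec3 _ _ _ *m g); ring.
have H3 (a b c : 'rV[F]_3) : a + b + c - (a + b) = c by rewrite [a + b + c]addrC addrK.
have H2 (a b c : 'rV[F]_3) : a + b + c - (a + c) = b by rewrite [a + b + c]addrAC H3.
have H1 (a b c : 'rV[F]_3) : a + b + c - (b + c) = a by rewrite -[a + b + c]addrA addrK.
case W1: (e1 *m g \in W); case W2: (e2 *m g \in W); case W3: (e3 *m g \in W);
  case W4: (e4 *m g \in W) => //; case: nfull; split=> //.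
- rewrite (_ : e3 *m g = e4 *m g - (e1 *m g + e2 *m g)) ?memvB ?memvD //.
  by rewrite e4E H3.
- rewrite (_ : e2 *m g = e4 *m g - (e1 *m g + e3 *m g)) ?memvB ?memvD //.
  by rewrite e4E H2.
- rewrite (_ : e1 *m g = e4 *m g - (e2 *m g + e3 *m g)) ?memvB ?memvD //.
  by rewrite e4E H1.
Qed.

Lemma baer_is_subplane : baer_subplane q baer.
Proof.
split.
- apply/subsetP => P /baerP[v [v0 _ ->]]; by rewrite vline_points // mulmx_unit_eq0.
- exact: baer_secants_meet.
- exact: baer_quadrangle.
by move=> l /secantP[u [v [[u0 v0 Fu Fv] uv ->]]]; apply: card_baer_secant.
Qed.

End BaerSubplanes.

(** * Subplanes of order q containing D *)

Section HallLines.
Variables (F : finFieldType) (q h : nat).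
Hypotheses (q_pow2 : q = (2 ^ h)%N) (q_gt1 : (1 < q)%N) (cardF : #|F| = (q ^ 2)%N).
Implicit Types (x y z a b u v lam mu : F) (P : subspace F) (B l m : {set subspace F}).

Local Notation affvec x y := (vec3 x y 1%R).
Local Notation infvec x y := (vec3 x y 0%R).

(** The matrix, acting on row vectors, of (x, y) |-> (lam x + a, lam y + b). *)
Definition affmx lam a b : 'M[F]_3 :=
  \matrix_(i < 3) [:: vec3 lam 0 0; vec3 0 lam 0; vec3 a b 1]`_i.

Lemma mul_affmx lam a b x y z :
  vec3 x y z *m affmx lam a b = vec3 (lam * x + a * z) (lam * y + b * z) z.
Proof.
apply: vec3_ext; rewrite vec3E mxE !big_ord_recl big_ord0 !mxE /= ?mxE /=; ring.
Qed.

Lemma affmx_unit lam a b : lam != 0 -> affmx lam a b \in unitmx.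
Proof.
move=> lam0; rewrite -row_free_unit; apply: inj_row_free => v.
rewrite (vec3_eta v) mul_affmx => /eqP; rewrite vec3_eq0 => /and3P[Ex Ey /eqP Ez].
move: Ex Ey; rewrite Ez !mulr0 !addr0 !mulf_eq0 (negPf lam0) /= => /eqP-> /eqP->.
by apply/eqP; rewrite vec3_eq0 eqxx.
Qed.

Lemma GFvec3 x y z : x \in GF F q -> y \in GF F q -> z \in GF F q -> GFvec q (vec3 x y z).
Proof. by move=> Fx Fy Fz; apply/forallP; apply: ord3P; rewrite vec3E. Qed.

Lemma pt_baer_affmx lam a b u v : u \in GF F q -> v \in GF F q ->
  pt (a + lam * u) (b + lam * v) 1 \in baer q (affmx lam a b).
Proof.
move=> Fu Fv; apply/baerP; exists (vec3 u v 1); split; first exact: vec3z1_neq0.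
  by apply: GFvec3 => //; apply: GF1.
by rewrite mul_affmx !mulr1 !(addrC (lam * _)).
Qed.

Lemma pt_baer_affmx_inv lam a b x y : lam != 0 -> pt x y 1 \in baer q (affmx lam a b) ->
  exists u v, [/\ u \in GF F q, v \in GF F q, x = a + lam * u & y = b + lam * v].
Proof.
move=> lam0 /baerP[w [w0 /forallP Fw]].
rewrite (vec3_eta w) mul_affmx; have := Fw i0; have := Fw i1; have := Fw i2.
move: (w 0 i0) (w 0 i1) (w 0 i2) => u v z Fz Fv Fu /eqP/(vline_eqP _ (vec3z1_neq0 x y))[k k0].
rewrite vec3Z => /vec3_inj[-> -> Ekz].
have z0 : z != 0 by apply: contraTneq (oner_neq0 F) => z0; rewrite Ekz z0 mulr0 eqxx.
have -> : k = z^-1 by apply: (mulIf z0); rewrite -Ekz mulVf.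
exists (u / z), (v / z); split; [exact: GFM (GFV _)|exact: GFM (GFV _)|by field|by field].
Qed.

Lemma derivation_baer lam a b : lam != 0 -> derivation_set F q \subset baer q (affmx lam a b).
Proof.
move=> lam0; apply/subsetP => P /derivP[x [y [Fx Fy xy ->]]]; apply/baerP.
have xy0 : vec3 x y 0 != 0 by rewrite vec3_eq0 eqxx andbT -xpair_eqE.
exists (vec3 x y 0); split=> //; first by apply: GFvec3 => //; apply: GF0.
by rewrite mul_affmx !mulr0 !addr0 -[X in vec3 _ _ X](mulr0 lam) -vec3Z vline_scale.
Qed.

Lemma baer_linf lam a b P : lam != 0 -> P \in baer q (affmx lam a b) -> P \in linf F ->
  P \in derivation_set F q.
Proof.
move=> lam0 /baerP[w [w0 /forallP Fw ->]].
move: w0; rewrite (vec3_eta w) mul_affmx; have := Fw i0; have := Fw i1.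
move: (w 0 i0) (w 0 i1) (w 0 i2) => x y z Fy Fx xyz0.
have wg0 : vec3 (lam * x + a * z) (lam * y + b * z) z != 0.
  by rewrite -mul_affmx mulmx_unit_eq0 ?affmx_unit.
rewrite mem_linf // vec3E => /eqP z0; apply/derivP; exists x, y.
split=> //; first by move: xyz0; rewrite vec3_eq0 z0 eqxx andbT xpair_eqE.
by rewrite z0 !mulr0 !addr0 -[X in vec3 _ _ X](mulr0 lam) -vec3Z vline_scale.
Qed.

Section Subplane.
Variable B : {set subspace F}.
Hypotheses (sub_B : subplane q B) (D_B : derivation_set F q \subset B).

Lemma joins_secant (p r : 'rV[F]_3) : p != 0 -> r != 0 -> <[p]>%VS != <[r]>%VS ->
  <[p]>%VS \in B -> <[r]>%VS \in B -> line_of (<[p]> + <[r]>)%VS \in secants B.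
Proof.
move=> p0 r0 pr pB rB; rewrite inE line_of_span //=; apply/card_gt1P.
exists <[p]>%VS, <[r]>%VS; split=> //; rewrite inE mem_line_of // ?pB ?rB andbT.
  by apply/mem_spanP; exists 1, 0; rewrite scale1r scale0r addr0.
by apply/mem_spanP; exists 0, 1; rewrite scale1r scale0r add0r.
Qed.

(** The lines through two affine points of B in two directions of D are secants of
B, as D is contained in B; if the directions differ, the common point of these
lines is in B. *)
Lemma parallelogram_closed a1 b1 a2 b2 u1 v1 u2 v2 lam :
  pt a1 b1 1 \in B -> pt a2 b2 1 \in B ->
  u1 \in GF F q -> v1 \in GF F q -> u2 \in GF F q -> v2 \in GF F q ->
  u1 * v2 != u2 * v1 ->
  a1 + lam * u1 = a2 + lam * u2 -> b1 + lam * v1 = b2 + lam * v2 ->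
  pt (a1 + lam * u1) (b1 + lam * v1) 1 \in B.
Proof.
move=> B1 B2 Fu1 Fv1 Fu2 Fv2 npar Ea Eb.
have [_ meet _ _] := sub_B.
have d1 : vec3 u1 v1 0 != 0.
  by rewrite vec3_eq0 eqxx andbT; apply: contraNN npar => /andP[/eqP-> /eqP->]; rewrite mul0r mulr0.
have d2 : vec3 u2 v2 0 != 0.
  by rewrite vec3_eq0 eqxx andbT; apply: contraNN npar => /andP[/eqP-> /eqP->]; rewrite mul0r mulr0.
have ne (a b u v : F) : vec3 u v 0 != 0 -> <[affvec a b]>%VS != <[infvec u v]>%VS.
  move=> uv0; apply/negP => /(vline_eqP _ (vec3z1_neq0 a b))[k _].
  by rewrite vec3Z => /vec3_inj[_ _] /eqP; rewrite mulr0 oner_eq0.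
have dB (u v : F) : u \in GF F q -> v \in GF F q -> vec3 u v 0 != 0 -> pt u v 0 \in B.
  move=> Fu Fv uv0; apply: (subsetP D_B); apply/derivP; exists u, v; split=> //.
  by move: uv0; rewrite vec3_eq0 eqxx andbT xpair_eqE.
have S1 := joins_secant (vec3z1_neq0 a1 b1) d1 (ne _ _ _ _ d1) B1 (dB _ _ Fu1 Fv1 d1).
have S2 := joins_secant (vec3z1_neq0 a2 b2) d2 (ne _ _ _ _ d2) B2 (dB _ _ Fu2 Fv2 d2).
have ll : line_of (<[affvec a1 b1]> + <[infvec u1 v1]>)%VS != line_of (<[affvec a2 b2]> + <[infvec u2 v2]>)%VS.
  apply: contraNneq npar => Ell.
  have : <[infvec u2 v2]>%VS \in line_of (<[affvec a1 b1]> + <[infvec u1 v1]>)%VS.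
    by rewrite Ell mem_line_of //; apply/mem_spanP; exists 0, 1; rewrite scale0r add0r scale1r.
  rewrite mem_line_of // => /mem_spanP[s [t]].
  rewrite !vec3Z vec3D => /vec3_inj[-> ->]; rewrite mulr0 mulr1 addr0 => <-.
  by rewrite !mul0r !add0r; apply/eqP; ring.
(* The common point x has third coordinate s; it is s times the expected point. *)
have [P PB] := meet _ _ S1 S2 ll.
have [x x0 EP] : exists2 x, x != 0 & P = <[x]>%VS.
  by apply: pointsP; have [/subsetP sB _ _ _] := sub_B; apply: sB.
rewrite inE EP !mem_line_of // => /andP[/mem_spanP[s [t Ex]] /mem_spanP[s' [t' Ex']]].
move: Ex'; rewrite Ex !vec3Z !vec3D => /vec3_inj[].
rewrite !mulr0 !addr0 !mulr1 => E1 E2 Es; subst s'.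
have npar' : u1 * v2 - u2 * v1 != 0 by rewrite subr_eq0.
have Et : t = s * lam.
  apply/eqP; rewrite -subr_eq0; apply/eqP/(mulfI npar'); rewrite mulr0.
  transitivity (v2 * ((s * a1 + t * u1) - (s * a2 + t' * u2) - s * ((a1 + lam * u1) - (a2 + lam * u2)))
    - u2 * ((s * b1 + t * v1) - (s * b2 + t' * v2) - s * ((b1 + lam * v1) - (b2 + lam * v2)))).
    by ring.
  by rewrite E1 E2 Ea Eb !subrr !mulr0 !subrr !mulr0 subrr.
have s0 : s != 0.
  by apply: contraNneq x0 => s0; rewrite Ex Et s0 mul0r !scale0r addr0.
move: PB; rewrite EP Ex Et -scalerA -scalerDr vline_scale // vec3Z vec3D.
by rewrite mulr0 addr0.
Qed.

Lemma subplane_affine_point : exists a b, pt a b 1 \in B.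
Proof.
have [/subsetP Bpts _ [S [/subsetP SB S4 Sl]] _] := sub_B.
have /set0Pn[P] : S :\: linf F != set0.
  by rewrite -card_gt0; have := cardsID (linf F) S; have := Sl _ (linf_line F); rewrite S4; lia.
rewrite inE => /andP[Pinf /SB PB].
have [a [b EP]] : exists a b, P = pt a b 1 by apply: affineP; rewrite inE Pinf Bpts.
by exists a, b; rewrite -EP.
Qed.

(** Let O = (a, b) be an affine point of B and C = (a + lam, b) a third point of B on
the line joining O to (1:0:0).  Then O + lam (u, v) = C + lam (u - 1, v) is in B by
[parallelogram_closed] if v != 0.  For v = 0 the directions (u, v) and (u - 1, v)
coincide, and E = (a, b + lam), with the direction (u, -1), replaces C. *)
Lemma subplane_contains_baer : exists lam a b, lam != 0 /\ baer q (affmx lam a b) \subset B.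
Proof.
have [a [b OB]] := subplane_affine_point.
have [F0 F1] : 0 \in GF F q /\ 1 \in GF F q by split; [exact: GF0 | exact: GF1].
have e10 : infvec 1 0 != 0 :> 'rV[F]_3 by rewrite vec3_eq0 oner_eq0.
have e1B : pt 1 0 0 \in B.
  by apply: (subsetP D_B); apply/derivP; exists 1, 0; rewrite xpair_eqE oner_eq0.
have Oe1 : <[affvec a b]>%VS != <[infvec 1%R 0%R]>%VS.
  by apply: (@vline_neq _ _ _ i2 i0); rewrite !vec3E mulr0 mulr1 oner_eq0.
have sec := joins_secant (vec3z1_neq0 a b) e10 Oe1 OB e1B.
have [_ _ _ /(_ _ sec) card_l] := sub_B.
(* The line has q + 1 > 2 points of B. *)
have /set0Pn[C] : (line_of (<[affvec a b]> + <[infvec 1%R 0%R]>)%VS :&: B) :\: [set pt a b 1; pt 1 0 0] != set0.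
  rewrite -card_gt0 cardsD card_l subn_gt0 ltnS.
  apply: leq_trans (subset_leq_card (subsetIr _ _)) _.
  by rewrite cards2; apply: leq_trans q_gt1; case: (_ != _).
rewrite !in_setD in_setI in_set2 negb_or => /andP[/andP[CO Ce1] /andP[Cl CB]].
have [lam lam0 EC] : exists2 lam, lam != 0 & C = pt (a + lam) b 1.
  have [Bpts _ _ _] := sub_B; have [c c0 EC] := pointsP (subsetP Bpts _ CB).
  move: Cl; rewrite EC mem_line_of // => /mem_spanP[s [t Ec]].
  have s0 : s != 0.
    apply: contraNneq Ce1 => s0; rewrite EC Ec s0 scale0r add0r vline_scale //.
    by apply: contraNneq c0 => t0; rewrite Ec s0 t0 !scale0r addr0.
  have t0 : t != 0.
    by apply: contraNneq CO => t0; rewrite EC Ec t0 scale0r addr0 vline_scale.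
  exists (t / s); first by rewrite mulf_neq0 ?invr_eq0.
  rewrite Ec /pt -/(vec3 _ _ _) -(vline_scale (vec3 (a + t / s) b 1) s0) !vec3Z vec3D.
  by congr (<[vec3 _ _ _]>%VS); field.
have gen u v : u \in GF F q -> v \in GF F q -> v != 0 -> pt (a + lam * u) (b + lam * v) 1 \in B.
  move=> Fu Fv v0; apply: (@parallelogram_closed a b (a + lam) b u v (u - 1) v) => //.
  - by rewrite -EC.
  - by apply: (GFB q_pow2 cardF).

  - by rewrite mulrBl mul1r -subr_eq0 opprB addrC subrK.
  - by ring.
have axis u : u \in GF F q -> pt (a + lam * u) b 1 \in B.
  move=> Fu; have [->|u0] := eqVneq u 0; first by rewrite mulr0 addr0.
  have EB : pt a (b + lam) 1 \in B.
    by have := gen 0 1 F0 F1 (oner_neq0 _); rewrite mulr0 addr0 mulr1.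
  rewrite -[b](_ : b + lam * 0 = b); last by rewrite mulr0 addr0.
  apply: (@parallelogram_closed a b a (b + lam) u 0 u (-1)) => //.
  - by apply: (GFN q_pow2 cardF).
  - by rewrite mulr0 mulrN1 oppr_eq0.
  - by ring.
exists lam, a, b; split=> //; apply/subsetP => P PB.
have [Pinf|Pinf] := boolP (P \in linf F).
  by apply: (subsetP D_B); apply: baer_linf PB Pinf.
have [x [y EP]] : exists x y, P = pt x y 1.
  apply: affineP; rewrite inE Pinf; have /baerP[w [w0 _ ->]] := PB.
  by rewrite vline_points ?mulmx_unit_eq0 ?affmx_unit.
move: PB; rewrite EP => /(pt_baer_affmx_inv lam0)[u [v [Fu Fv -> ->]]].
by have [->|v0] := eqVneq v 0; [rewrite mulr0 addr0; apply: axis | apply: gen].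
Qed.

End Subplane.

(** A secant l of B has q + 1 points in B and in B', hence the same points in both.
Let A be a point of B off l.  For X in B' the line AX meets l in a point of B',
hence of B; so AX is a secant of B, and X is in B. *)
Lemma subplane_sub_eq (B B' : {set subspace F}) : subplane q B -> subplane q B' ->
  B \subset B' -> B = B'.
Proof.
move=> subB subB' BB'; apply/eqP; rewrite eqEsubset BB' /=.
have [Bpts meet [S [/subsetP SB S4 Sl]] cardB] := subB.
have [/subsetP B'pts meet' _ cardB'] := subB'.
have sec_sub l : l \in secants B -> l \in secants B'.
  rewrite !inE => /andP[-> cl]; apply: leq_trans cl _.
  by apply: subset_leq_card; apply: setIS.
have sec_eq l : l \in secants B -> l :&: B = l :&: B'.
  move=> lB; apply/eqP; rewrite eqEcard setIS //= cardB // cardB' //.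
  exact: sec_sub.
have onsec l P : l \in secants B -> P \in l -> P \in B' -> P \in B.
  by move=> lB Pl PB'; have : P \in l :&: B' by [rewrite inE Pl]; rewrite -sec_eq // inE => /andP[].
have secE (P R : subspace F) : P \in B' -> R \in B' -> P != R ->
    exists l, [/\ l \in secants B', P \in l & R \in l].
  move=> PB RB PR; have [p p0 EP] := pointsP (B'pts _ PB); have [r r0 ER] := pointsP (B'pts _ RB).
  rewrite EP ER in PB RB PR *; exists (line_of (<[p]> + <[r]>)%VS); split.
  - exact: joins_secant.
  - by rewrite mem_line_of //; apply/mem_spanP; exists 1, 0; rewrite scale1r scale0r addr0.
  - by rewrite mem_line_of //; apply/mem_spanP; exists 0, 1; rewrite scale1r scale0r add0r.
have /card_gt1P[P [R [PS RS PR]]] : (1 < #|S|)%N by rewrite S4.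
have PB := SB _ PS; have RB := SB _ RS.
have [l [lB' Pl Rl]] := secE _ _ (subsetP BB' _ PB) (subsetP BB' _ RB) PR.
have lB : l \in secants B.
  move: lB'; rewrite !inE => /andP[-> _] /=; apply/card_gt1P; exists P, R.
  by rewrite !inE Pl Rl PB RB.
have /set0Pn[A] : S :\: l != set0.
  rewrite -card_gt0; have := cardsID l S; rewrite S4.
  have : (#|S :&: l| <= 2)%N by apply: Sl; move: lB; rewrite inE => /andP[].
  by move: #|S :&: l| #|S :\: l| => c d; clear; lia.
rewrite inE => /andP[Al /SB AB]; apply/subsetP => X XB'.
have [<- //|AX] := eqVneq A X.
have [m [mB' Am Xm]] := secE _ _ (subsetP BB' _ AB) XB' AX.
have lm : l != m by apply: contraNneq Al => ->.
have [Y YB' /setIP[Yl Ym]] := meet' _ _ lB' mB' lm.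
have YB := onsec _ _ lB Yl YB'.
apply: (onsec m) => //; move: mB'; rewrite !inE => /andP[-> _] /=.
apply/card_gt1P; exists A, Y; rewrite !inE Am AB Ym YB; split=> //.
by apply: contraNneq Al => ->.
Qed.

Lemma subplane_baer (B : {set subspace F}) : subplane q B -> derivation_set F q \subset B ->
  exists lam a b, lam != 0 /\ B = baer q (affmx lam a b).
Proof.
move=> subB DB; have [lam [a [b [lam0 sub]]]] := subplane_contains_baer subB DB.
exists lam, a, b; split=> //; apply/esym/subplane_sub_eq => //.
exact: (baer_is_subplane q_pow2 q_gt1 cardF (affmx_unit a b lam0)).
Qed.
End HallLines.

(** * The normal form of the hyperbola and its intersections *)

Section Hyperbola.
Variables (F : finFieldType) (q h : nat).
Hypotheses (q_pow2 : q = (2 ^ h)%N) (q_gt1 : (1 < q)%N) (cardF : #|F| = (q ^ 2)%N).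

Lemma quadform_over (e t n f g k : F) : e \in GF F q -> t \in GF F q -> n \in GF F q ->
  f \in GF F q -> g \in GF F q -> k \in GF F q -> quadform e t n f g k \is a mpolyOver 3 (GF F q).
Proof.
move=> Fe Ft Fn Ff Fg Fk; apply/allP => _ /mapP[m _ ->].
change ((quadform e t n f g k)@_m \in GF F q).
have Fb c (b : bool) : c \in GF F q -> c *+ b \in GF F q by case: b => // _; apply: GF0.
have D := GFD q_pow2 cardF.
rewrite /quadform !mcoeffD !mcoeffCX.
exact: (D _ _ (D _ _ (D _ _ (D _ _ (D _ _ (Fb _ _ Fe) (Fb _ _ Ft)) (Fb _ _ Fn)) (Fb _ _ Ff)) (Fb _ _ Fg)) (Fb _ _ Fk)).
Qed.

Section NormalForm.
Variables (p1 p2 r1 r2 : F).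
Hypothesis delta_neq0 : p1 * r2 - p2 * r1 != 0.
Local Notation splitform := (splitform p1 p2 r1 r2).

(** The zeros of the equation at infinity determine its first three coefficients up
to a factor [k1] by [binary_form_roots]; irreducibility excludes k1 = 0, where z
would be a factor, and mu = 0, where the equation would be the product of the two
asymptotes through (x0, y0). *)
Lemma conic_normal_form (K : {set subspace F}) : conic K ->
  pt p1 p2 0 \in K -> pt r1 r2 0 \in K ->
  exists x0 y0 mu, mu != 0 /\ forall x y z, (x, y, z) != (0, 0, 0) ->
    (pt x y z \in K) = (splitform (x - x0 * z) (y - y0 * z) == mu ^+ 2 * z ^+ 2).
Proof.
move=> [Q [/quadform_eq[e [t [n [f [g [k ->]]]]]] irr ->]].
have p0 : (p1, p2, 0) != (0, 0, 0) :> F * F * F.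
  by rewrite !xpair_eqE eqxx andbT; apply: contraNN delta_neq0 => /andP[/eqP-> /eqP->]; rewrite !mul0r subrr.
have r0 : (r1, r2, 0) != (0, 0, 0) :> F * F * F.
  by rewrite !xpair_eqE eqxx andbT; apply: contraNN delta_neq0 => /andP[/eqP-> /eqP->]; rewrite !mulr0 subrr.
rewrite !mem_zeros_pt // expr0n !mulr0 !addr0 => /eqP Pp /eqP Rr.
have [k1 N1 Et] := binary_form_roots q_pow2 cardF delta_neq0 Pp Rr.
have k10 : k1 != 0.
  apply/eqP => k10; apply: (@irreducible_no_linear_factors F e t n f g k f g k 0 0 1 irr) => x y z.
  by rewrite N1 k10; ring.
have [x0 [y0 centre]] := splitform_centre q_pow2 cardF delta_neq0 (f / k1) (g / k1).
have Qval x y z : e * x ^+ 2 + t * (x * y) + n * y ^+ 2 + f * (x * z) + g * (y * z) + k * z ^+ 2 =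
   k1 * (splitform (x - x0 * z) (y - y0 * z) - (splitform x0 y0 - k / k1) * z ^+ 2).
  transitivity (k1 * (splitform x y + f / k1 * (x * z) + g / k1 * (y * z)) + k * z ^+ 2).
    by rewrite N1; field.
  by rewrite centre; field.
have [mu Emu] := square_root q_pow2 q_gt1 cardF (splitform x0 y0 - k / k1).
exists x0, y0, mu; split=> [|x y z xyz].
  apply/eqP => mu0; apply: (@irreducible_no_linear_factors F e t n f g k
    (k1 * p2) (- (k1 * p1)) (- (k1 * (p2 * x0 - p1 * y0))) r2 (- r1) (- (r2 * x0 - r1 * y0)) irr) => x y z.
  by rewrite Qval Emu mu0 /splitform; ring.
by rewrite mem_zeros_pt // Qval Emu mulf_eq0 (negPf k10) subr_eq0.
Qed.

Variables (K : {set subspace F}) (x0 y0 mu : F).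
Hypothesis mu_neq0 : mu != 0.
Hypothesis memK : forall x y z, (x, y, z) != (0, 0, 0) ->
    (pt x y z \in K) = (splitform (x - x0 * z) (y - y0 * z) == mu ^+ 2 * z ^+ 2).

Let B0 := baer q (affmx mu x0 y0).

Lemma memK_affine x y : (pt x y 1 \in K) = (splitform (x - x0) (y - y0) == mu ^+ 2).
Proof.
by rewrite memK ?xpair_eqE ?oner_eq0 ?andbF // !mulr1 expr1n mulr1.
Qed.

Lemma mu2_neq0 : mu ^+ 2 != 0. Proof. by rewrite sqrf_eq0. Qed.

Lemma affine_meet_sub (L : {set subspace F}) : L \subset points F ->
  affine_part L :&: affine_part K \subset points F :\: linf F.
Proof.
move=> /subsetP Lp; apply/subsetP => P; rewrite in_setI [_ \in affine_part L]in_setD.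
by case/andP => /andP[Pinf /Lp Pp] _; rewrite in_setD Pinf.
Qed.

(** A third point of the line joining (x1, y1) and (x2, y2) is an affine combination
of these two, so [splitform_collinear] applies. *)
Lemma line_conic_le2 (l : {set subspace F}) : l \in lines F ->
  (#|affine_part l :&: affine_part K| <= 2)%N.
Proof.
move=> ll; rewrite leqNgt; apply/negP => /three_affine[].
  by apply: affine_meet_sub; case/imsetP: ll => W _ ->; apply/subsetP => P; rewrite inE => /andP[].
move=> x1 [y1 [x2 [y2 [x3 [y3 [[]]]]]]]; rewrite !in_setI !in_setD !memK_affine.
move=> /and3P[/andP[_ l1] _ /eqP K1] /and3P[/andP[_ l2] _ /eqP K2] /and3P[/andP[_ l3] _ /eqP K3] n12 n13 n23.
have ne : <[vec3 x1 y1 1%R]>%VS != <[vec3 x2 y2 1%R]>%VS.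
  by apply: contraNneq n12 => /pt_affine_inj[-> ->].
have El := line_through (vec3z1_neq0 x1 y1) (vec3z1_neq0 x2 y2) ne ll l1 l2.
move: l3; rewrite El mem_line_of ?vec3z1_neq0 // => /mem_spanP[s [t]].
rewrite !vec3Z vec3D => /vec3_inj[Ex Ey]; rewrite !mulr1 => Est.
have col : (x2 - x0 - (x1 - x0)) * (y3 - y0 - (y1 - y0)) = (x3 - x0 - (x1 - x0)) * (y2 - y0 - (y1 - y0)).
  by rewrite Ex Ey (_ : s = 1 - t); [ring | rewrite Est addrK].
have [] := splitform_collinear delta_neq0 mu2_neq0 K1 K2 K3 col.
- by case=> /addIr E /addIr E'; rewrite E E' eqxx in n12.
- by case=> /addIr E /addIr E'; rewrite E E' eqxx in n13.
- by case=> /addIr E /addIr E'; rewrite E E' eqxx in n23.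
Qed.

Hypotheses (GF_e : p2 * r2 \in GF F q) (GF_n : p1 * r1 \in GF F q) (GF_t : p2 * r1 + p1 * r2 \in GF F q).

(** One inclusion suffices by [subplane_sub_eq]. *)
Lemma baer_affmx_eq lam a b : lam != 0 -> (a - x0) / lam \in GF F q -> (b - y0) / lam \in GF F q ->
  mu / lam \in GF F q -> baer q (affmx lam a b) = B0.
Proof.
move=> lam0 Fa Fb Fm.
have g_unit := affmx_unit a b lam0; have g0_unit := affmx_unit x0 y0 mu_neq0.
apply: (subplane_sub_eq (baer_is_subplane q_pow2 q_gt1 cardF g_unit) (baer_is_subplane q_pow2 q_gt1 cardF g0_unit)).
apply/subsetP => P PB; have [Pinf|Pinf] := boolP (P \in linf F).
  by apply: (subsetP (derivation_baer q_gt1 x0 y0 mu_neq0)); apply: baer_linf PB Pinf.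
have [x [y EP]] : exists x y, P = pt x y 1.
  apply: affineP; rewrite inE Pinf; have /baerP[w [w0 _ ->]] := PB.
  by rewrite vline_points ?mulmx_unit_eq0.
move: PB; rewrite EP => /(pt_baer_affmx_inv lam0)[u [v [Fu Fv -> ->]]].
have D := GFD q_pow2 cardF.
have -> : a + lam * u = x0 + mu * (((a - x0) / lam + u) * (mu / lam)^-1) by field; rewrite ?mu_neq0 ?lam0.
have -> : b + lam * v = y0 + mu * (((b - y0) / lam + v) * (mu / lam)^-1) by field; rewrite ?mu_neq0 ?lam0.
by apply: pt_baer_affmx; apply: GFM (GFV _) => //; apply: D.
Qed.

Lemma new_line_conic_le2 (L : {set subspace F}) : new_line q L -> L <> affine_part B0 ->
  (#|L :&: affine_part K| <= 2)%N.
Proof.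
move=> [B [subB DB ->]] neq; rewrite leqNgt; apply/negP => /three_affine[].
  by apply: affine_meet_sub; case: subB.
have [lam [a [b [lam0 EB]]]] := subplane_baer q_pow2 q_gt1 cardF subB DB.
move=> x1 [y1 [x2 [y2 [x3 [y3 [[]]]]]]]; rewrite !in_setI !in_setD !memK_affine EB.
move=> /and3P[/andP[_ B1] _ /eqP K1] /and3P[/andP[_ B2] _ /eqP K2] /and3P[/andP[_ B3] _ /eqP K3].
move: B1 K1 B2 K2 B3 K3.
move=> /(pt_baer_affmx_inv lam0)[u1 [v1 [Fu1 Fv1 -> ->]]] K1.
move=> /(pt_baer_affmx_inv lam0)[u2 [v2 [Fu2 Fv2 -> ->]]] K2.
move=> /(pt_baer_affmx_inv lam0)[u3 [v3 [Fu3 Fv3 -> ->]]] K3 n12 n13 n23.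
have rel u v : splitform (a + lam * u - x0) (b + lam * v - y0) = mu ^+ 2 ->
    splitform ((a - x0) / lam + u) ((b - y0) / lam + v) = (mu / lam) ^+ 2.
  move=> Nuv; have lam20 : lam ^+ 2 != 0 by rewrite sqrf_eq0.
  have E c d w : c + lam * w - d = lam * ((c - d) / lam + w) by field.
  by apply: (mulfI lam20); rewrite -splitform_scale -!E Nuv; field.
have neq_uv u v u' v' : (a + lam * u, b + lam * v) != (a + lam * u', b + lam * v') -> (u, v) != (u', v').
  by apply: contraNneq => -[-> ->].
have d0 : (mu / lam) ^+ 2 != 0 by rewrite sqrf_eq0 mulf_neq0 ?invr_eq0.
have [Fa Fb Fd] := splitform_new_line q_pow2 cardF delta_neq0 GF_e GF_n GF_t d0
  Fu1 Fv1 Fu2 Fv2 Fu3 Fv3 (neq_uv _ _ _ _ n12) (neq_uv _ _ _ _ n13) (neq_uv _ _ _ _ n23)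
  (rel _ _ K1) (rel _ _ K2) (rel _ _ K3).
by apply: neq; rewrite EB (baer_affmx_eq lam0 Fa Fb) // (GF_sqr q_pow2 cardF).
Qed.

Lemma hall_line_conic_le2 (L : {set subspace F}) : hall_line q L -> L <> affine_part B0 ->
  (#|L :&: affine_part K| <= 2)%N.
Proof. by case=> [[l [ll _ _ ->]] _|]; [apply: line_conic_le2 | apply: new_line_conic_le2]. Qed.

Lemma conic_of_baer : conic_of_subplane q B0 (K :&: B0).
Proof.
have g_unit := affmx_unit x0 y0 mu_neq0.
exists (affmx mu x0 y0), (quadform (p2 * r2) (- (p2 * r1 + p1 * r2)) (p1 * r1) 0 0 (-1)).
have N := GFN q_pow2 cardF.
have valQ x y z : vec3 x y z != 0 -> (pt (mu * x + x0 * z) (mu * y + y0 * z) z \in K) =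
    (<[vec3 x y z]>%VS \in zeros (quadform (p2 * r2) (- (p2 * r1 + p1 * r2)) (p1 * r1) 0 0 (-1))).
  move=> v0; rewrite mem_zeros_pt; last by move: v0; rewrite vec3_eq0 !xpair_eqE -andbA.
  have v1 : vec3 (mu * x + x0 * z) (mu * y + y0 * z) z != 0 by rewrite -mul_affmx mulmx_unit_eq0.
  rewrite memK; last by move: v1; rewrite vec3_eq0 !xpair_eqE -andbA.
  rewrite !addrK splitform_scale -subr_eq0 -mulrBr mulf_eq0 (negPf mu2_neq0) /splitform /=.
  by congr (_ == _); ring.
split=> //.
- split; first exact: quadform_homog.
  move=> L phi; rewrite map_quadform rmorph0; apply: quadform_irreducible.
  + by rewrite -(rmorph_nat phi) (two_eq0 q_pow2 cardF) rmorph0.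
  + by rewrite fmorph_eq0 oppr_eq0 (polar_neq0 q_pow2 cardF).
  + by rewrite fmorph_eq0 oppr_eq0 oner_eq0.
- by apply: quadform_over => //; try (apply: N => //); [apply: GF0|apply: GF0|apply: GF1].
apply/setP => P; rewrite in_setI; apply/andP/imsetP.
  case=> PK /baerP[v [v0 Fv EP]]; exists <[v]>%VS; last by rewrite projectivity_vline.
  rewrite in_setI; apply/andP; split; first by apply/PGsubP; exists v.
  move: v0 PK; rewrite EP (vec3_eta v) mul_affmx => v0.
  by rewrite -valQ.
case=> R; rewrite in_setI => /andP[/PGsubP[v [v0 Fv ->]] Rz]; rewrite projectivity_vline => ->.
split; last by apply/baerP; exists v.
by move: v0 Rz; rewrite (vec3_eta v) mul_affmx => v0; rewrite -valQ.
Qed.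

(** A point (u, v) with N(u, v) = 1 is determined by s = p2 u - p1 v, since
r2 u - r1 v = s^-1; solving for u and v inverts this correspondence.  The set S
consists of the values of s that belong to points over GF(q). *)
Lemma card_baer_conic (S : {set F}) : (forall s, s \in S -> s != 0) ->
  (forall u v, splitform u v = 1 -> (u \in GF F q) && (v \in GF F q) = (p2 * u - p1 * v \in S)) ->
  #|affine_part B0 :&: affine_part K| = #|S|.
Proof.
move=> S0 HS; pose d := p1 * r2 - p2 * r1; have d0 : d != 0 := delta_neq0.
pose us s := (p1 * s^-1 - r1 * s) / d; pose vs s := (p2 * s^-1 - r2 * s) / d.
have s_of s : s != 0 -> p2 * us s - p1 * vs s = s.
  by move=> s0; rewrite /us /vs /d; field; rewrite ?s0 ?delta_neq0.
have N1 s : s != 0 -> splitform (us s) (vs s) = 1.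
  by move=> s0; rewrite /splitform s_of // /us /vs /d; field; rewrite ?s0 ?delta_neq0.
have of_s u v : splitform u v = 1 -> u = us (p2 * u - p1 * v) /\ v = vs (p2 * u - p1 * v).
  move=> Nuv; have s0 : p2 * u - p1 * v != 0.
    by apply: contra_eq_neq Nuv => s0; rewrite /splitform s0 mul0r eq_sym oner_eq0.
  have Ew : (p2 * u - p1 * v)^-1 = r2 * u - r1 * v by apply: (mulfI s0); rewrite mulfV // -Nuv.
  by rewrite /us /vs Ew /d; split; field; rewrite ?delta_neq0.
pose pnt s := pt (x0 + mu * us s) (y0 + mu * vs s) 1.
have -> : affine_part B0 :&: affine_part K = [set pnt s | s in S].
  have Nrel u v : splitform (x0 + mu * u - x0) (y0 + mu * v - y0) = mu ^+ 2 * splitform u v.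
    by rewrite -splitform_scale; congr (splitform _ _); ring.
  apply/setP => P; apply/idP/imsetP.
    move=> PBK; have Bp : B0 \subset points F by case: (baer_is_subplane q_pow2 q_gt1 cardF (affmx_unit x0 y0 mu_neq0)).
    have [x [y EP]] := affineP (subsetP (affine_meet_sub Bp) _ PBK).
    move: PBK; rewrite EP !in_setI !in_setD memK_affine => /and3P[/andP[_ PB] _ /eqP].
    have [u [v [Fu Fv -> ->]]] := pt_baer_affmx_inv mu_neq0 PB.
    rewrite Nrel -[RHS]mulr1 => /(mulfI mu2_neq0) Nuv.
    have [Eu Ev] := of_s _ _ Nuv; exists (p2 * u - p1 * v); first by rewrite -HS ?Fu.
    by rewrite /pnt -Eu -Ev.
  case=> s Ss ->; have := N1 _ (S0 _ Ss) => Ns.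
  have := HS _ _ Ns; rewrite s_of ?S0 // Ss => /andP[Fu Fv].
  have paff := pt_affine (x0 + mu * us s) (y0 + mu * vs s).
  move: paff; rewrite !in_setI !in_setD => /andP[-> _] /=.
  by rewrite memK_affine Nrel Ns mulr1 eqxx andbT; apply: pt_baer_affmx.
apply: card_in_imset => s s' Ss Ss' /pt_affine_inj[/addrI/(mulfI mu_neq0) Eu /addrI/(mulfI mu_neq0) Ev].
by rewrite -(s_of s) ?S0 // -(s_of s') ?S0 // Eu Ev.
Qed.
End NormalForm.
End Hyperbola.

(** * Coordinates of the two infinite points *)

Section InfinitePoints.
Variables (F : finFieldType) (q h : nat).
Hypotheses (q_pow2 : q = (2 ^ h)%N) (q_gt1 : (1 < q)%N) (cardF : #|F| = (q ^ 2)%N).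

Lemma deriv_coords (P R : subspace F) : P != R ->
  P \in derivation_set F q -> R \in derivation_set F q ->
  exists p1 p2 r1 r2, [/\ P = pt p1 p2 0, R = pt r1 r2 0, p1 * r2 - p2 * r1 != 0,
    p1 \in GF F q /\ p2 \in GF F q & r1 \in GF F q /\ r2 \in GF F q].
Proof.
move=> PR /derivP[p1 [p2 [F1 F2 p0 EP]]] /derivP[r1 [r2 [F1' F2' r0 ER]]].
exists p1, p2, r1, r2; split=> //; apply: infinite_points_det.
- by rewrite vec3_eq0 eqxx andbT -xpair_eqE.
- by rewrite -EP -ER.
- by rewrite vec3_eq0 eqxx andbT -xpair_eqE.
Qed.

(** The vector of P chosen in the definition of conjugacy has third coordinate 0, and
its image under x |-> x^q spans R. *)
Lemma conj_coords (P R : subspace F) : P != R -> conjugate_points q P R ->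
  exists p1 p2, [/\ P = pt p1 p2 0, R = pt (p1 ^+ q) (p2 ^+ q) 0 &
    p1 * p2 ^+ q - p2 * p1 ^+ q != 0].
Proof.
move=> PR [/setDP[Pinf _] /setDP[Rinf _] PfR _].
have Pp : P \in points F by move: Pinf; rewrite inE => /andP[].
have dP : \dim P = 1%N by apply/eqP; move: Pp; rewrite inE.
have v0 : vpick P != 0 by rewrite vpick0 -dimv_eq0 dP.
have EP : P = <[vpick P]>%VS.
  by apply/esym/eqP; rewrite eqEdim dP dim_vline v0 -memvE memv_pick.
have v2 : vpick P 0 i2 = 0 by move: Pinf; rewrite {1}EP mem_linf // => /eqP.
pose p1 := vpick P 0 i0; pose p2 := vpick P 0 i1.
have Ev : vpick P = vec3 p1 p2 0 by rewrite {1}(vec3_eta (vpick P)) v2.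
have EP' : P = pt p1 p2 0 by rewrite {1}EP {1}Ev.
have ER : R = pt (p1 ^+ q) (p2 ^+ q) 0.
  rewrite -PfR /frob_pt Ev; congr (<[_]>%VS); apply: vec3_ext; rewrite mxE !vec3E //.
  by rewrite expr0n gtn_eqF // ltnW.
exists p1, p2; split=> //; apply: infinite_points_det.
- have := v0; rewrite Ev !vec3_eq0 !eqxx !andbT; apply: contraNN.
  by rewrite !expf_eq0 => /andP[/andP[_ ->] /andP[_ ->]].
- by rewrite -EP' -ER.
- by rewrite -Ev.
Qed.
End InfinitePoints.

Theorem proposition4p1 (F : finFieldType) (q h : nat)
    (q_pow2 : q = (2 ^ h)%N) (q_ge4 : (4 <= q)%N) (cardF : #|F| = (q ^ 2)%N)
    (K : {set subspace F}) (K_hyp : hyperbola K)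
    (P R : subspace F) (PneqR : P != R) (K_inf : K :&: linf F = [set P; R])
    (K_cases : (P \in derivation_set F q /\ R \in derivation_set F q)
               \/ conjugate_points q P R) :
  exists B : {set subspace F},
    [/\ baer_subplane q B /\ derivation_set F q \subset B,
        conic_of_subplane q B (K :&: B),
        (P \in derivation_set F q /\ R \in derivation_set F q ->
           #|affine_part B :&: affine_part K| = (q - 1)%N),
        (conjugate_points q P R ->
           #|affine_part B :&: affine_part K| = (q + 1)%N) &
        (forall L : {set subspace F}, hall_line q L -> L <> affine_part B ->
           (#|L :&: affine_part K| <= 2)%N)].
Proof.
have q_gt1 : (1 < q)%N by apply: leq_trans q_ge4.
have [M V] := (@GFM F q, @GFV F q).
have [D B] := (GFD q_pow2 cardF, GFB q_pow2 cardF).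
have fD := frobD q_pow2 cardF; have fB := frobB q_pow2 cardF; have fK := frobK cardF.
have [PK RK] : P \in K /\ R \in K.
  by split; apply: (subsetP (subsetIl K (linf F))); rewrite K_inf in_set2 eqxx ?orbT.
have [Kconic _] := K_hyp.
case: K_cases => [[PD RD]|PRconj].
  have [p1 [p2 [r1 [r2 [EP ER det [Fp1 Fp2] [Fr1 Fr2]]]]]] := deriv_coords PneqR PD RD.
  rewrite EP in PK; rewrite ER in RK.
  have [x0 [y0 [mu [mu0 memK]]]] := conic_normal_form q_pow2 q_gt1 cardF det Kconic PK RK.
  exists (baer q (affmx mu x0 y0)); split.
  - split; last exact: derivation_baer.
    by apply: (baer_is_subplane q_pow2 q_gt1 cardF); apply: affmx_unit.
  - apply: (conic_of_baer q_pow2 q_gt1 cardF det mu0 memK); [exact: M|exact: M|].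
    by apply: D; apply: M.
  - move=> _; rewrite -(card_GF_star q_pow2 q_gt1 cardF).
    apply: (card_baer_conic q_pow2 q_gt1 cardF det mu0 memK) => [s|u v Nuv].
      by rewrite inE => /andP[].
    have s0 : p2 * u - p1 * v != 0.
      by apply: contra_eq_neq Nuv => s0; rewrite /splitform s0 mul0r eq_sym oner_eq0.
    have Ew : (p2 * u - p1 * v)^-1 = r2 * u - r1 * v by apply: (mulfI s0); rewrite mulfV // -Nuv.
    rewrite [RHS]in_set s0 andbT; apply/andP/idP => [[Fu Fv]|Fs]; first by apply: B; apply: M.
    (* Conversely u and v are rational expressions in s and the coordinates of P and R. *)
    have Fw := V _ Fs; have Fd := V _ (B _ _ (M _ _ Fp1 Fr2) (M _ _ Fp2 Fr1)).
    have Eu : u = (p1 * (p2 * u - p1 * v)^-1 - r1 * (p2 * u - p1 * v)) * (p1 * r2 - p2 * r1)^-1.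
      by rewrite Ew; field.
    have Ev : v = (p2 * (p2 * u - p1 * v)^-1 - r2 * (p2 * u - p1 * v)) * (p1 * r2 - p2 * r1)^-1.
      by rewrite Ew; field.
    by split; [rewrite Eu|rewrite Ev]; apply: (M _ _ _ Fd); apply: (B); apply: (M).
  - by case=> /setDP[_]; rewrite PD.
  - move=> L HL neq; apply: (hall_line_conic_le2 q_pow2 q_gt1 cardF det mu0 memK _ _ _ HL neq);
      [exact: M|exact: M|by apply: D; apply: M].
have [p1 [p2 [EP ER det]]] := conj_coords q_gt1 PneqR PRconj.
rewrite EP in PK; rewrite ER in RK.
have [x0 [y0 [mu [mu0 memK]]]] := conic_normal_form q_pow2 q_gt1 cardF det Kconic PK RK.
have Fe : p2 * p2 ^+ q \in GF F q by apply/GFP; rewrite exprMn fK mulrC.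
have Fn : p1 * p1 ^+ q \in GF F q by apply/GFP; rewrite exprMn fK mulrC.
have Ft : p2 * p1 ^+ q + p1 * p2 ^+ q \in GF F q.
  by apply/GFP; rewrite fD !exprMn !fK addrC mulrC [X in _ + X]mulrC.
exists (baer q (affmx mu x0 y0)); split.
- split; last exact: derivation_baer.
  by apply: (baer_is_subplane q_pow2 q_gt1 cardF); apply: affmx_unit.
- exact: (conic_of_baer q_pow2 q_gt1 cardF det mu0 memK).
- by case=> PD _; case: PRconj => /setDP[_]; rewrite PD.
- move=> _; rewrite addn1 -(card_norm1 q_pow2 q_gt1 cardF).
  apply: (card_baer_conic q_pow2 q_gt1 cardF det mu0 memK) => [s|u v Nuv].
    by rewrite in_set; apply: contraTneq => ->; rewrite expr0n eq_sym oner_eq0.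
  set s := p2 * u - p1 * v.
  have s0 : s != 0.
    by apply: contra_eq_neq Nuv => s0; rewrite /splitform -/s s0 mul0r eq_sym oner_eq0.
  have Ew : s^-1 = p2 ^+ q * u - p1 ^+ q * v by apply: (mulfI s0); rewrite mulfV // -Nuv.
  rewrite [RHS]in_set exprS; apply/andP/eqP => [[/GFP Fu /GFP Fv]|Ns].
    by rewrite {2}/s fB !exprMn Fu Fv -Ew mulfV.
  have {}Ns : s ^+ q = s^-1 by apply: (mulfI s0); rewrite Ns mulfV.
  (* The Frobenius map exchanges s and s^-1 as well as p and r, so it negates both the
     numerators and the denominator in the formulas for u and v. *)
  have Fd : (p1 * p2 ^+ q - p2 * p1 ^+ q) ^+ q = - (p1 * p2 ^+ q - p2 * p1 ^+ q).
    by rewrite fB !exprMn !fK; ring.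
  have Eu : u * (p1 * p2 ^+ q - p2 * p1 ^+ q) = p1 * s ^+ q - p1 ^+ q * s by rewrite Ns Ew /s; ring.
  have Ev : v * (p1 * p2 ^+ q - p2 * p1 ^+ q) = p2 * s ^+ q - p2 ^+ q * s by rewrite Ns Ew /s; ring.
  split; apply/GFP; apply: (mulIf det); apply: oppr_inj.
    by rewrite -mulrN -Fd -exprMn Eu fB !exprMn !fK; ring.
  by rewrite -mulrN -Fd -exprMn Ev fB !exprMn !fK; ring.
by move=> L HL neq; apply: (hall_line_conic_le2 q_pow2 q_gt1 cardF det mu0 memK Fe Fn Ft HL neq).
Qed.
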